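(* Suppose the data $x$ (of sample size $n$) follows an exponential family model $f(x|\theta)$ with canonical parameters $\theta\in\mathbb{R}^p$, $p\ge 1$. Let $\hat\theta$ be the maximum likelihood estimate of $\theta$, and let $\hat\theta_{MML}$ be the Minimum Message Length (MML) estimate with prior $h$. If $$h(\theta)\propto |I_x(\theta)|,$$ then the MML estimates remove the $O(n^{-1})$ term in the bias of $\hat\theta$.
   Context: $I_x(\theta)$ is Fisher's information matrix for $x$ and $|I_x(\theta)|$ its determinant. The MML (MML87) estimate $\hat\theta_{MML}$ with prior $h(\theta)$ is the value of $\theta$ maximizing $$\log h(\theta)+\log f(x|\theta)-\tfrac12\log|I_x(\theta)|.$$ ''Remove the $O(n^{-1})$ term in the bias'' means: if the bias of $\hat\theta$ has the usual asymptotic expansion $E_\theta\hat\theta-\theta=b_1(\theta)/n+b_2(\theta)/n^2+\cdots$ as the sample size $n\to\infty$ (in the regular setting where such expansions hold), then the corresponding expansion of the bias of $\hat\theta_{MML}$ has no term of order $n^{-1}$. *)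

(* Defs.v *)
From HB Require Import structures.
From mathcomp Require Import all_boot all_order all_algebra.
From mathcomp Require Import all_classical all_reals all_analysis.

Set Implicit Arguments.
Unset Strict Implicit.
Unset Printing Implicit Defensive.

Import Order.TTheory GRing.Theory Num.Theory numFieldNormedType.Exports.

Local Open Scope classical_set_scope.
Local Open Scope ring_scope.

(* The norm [`| _ |] of ['rV[R]_p] is the sup norm. *)

Definition dotr (R : realType) (p : nat) (u v : 'rV[R]_p) : R :=
  \sum_(i < p) u ord0 i * v ord0 i.

(* A p-parameter exponential family in canonical form,
     f(x | theta) = b(x) exp(<theta, T(x)> - K(theta)),
   a density with respect to the measure [ef_base]; the normalization K is
   [log_partition] below.  [ef_space] is the space of the whole data set x, so
   an i.i.d. sample of size n is the case of an n-fold product space, with T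
   the sum of the sufficient statistics of the observations. *)
Record exp_family (R : realType) (p : nat) := ExpFamily {
  ef_disp : measure_display;
  ef_space : measurableType ef_disp;
  ef_base : {measure set ef_space -> \bar R};
  ef_carrier : ef_space -> R;
  ef_stat : ef_space -> 'rV[R]_p;
  ef_carrier_ge0 : forall x, 0 <= ef_carrier x;
  ef_carrier_measurable : measurable_fun setT ef_carrier;
  ef_stat_measurable : forall i : 'I_p,
    measurable_fun setT (fun x => ef_stat x ord0 i)
}.

Section Model.
Variables (R : realType) (p : nat) (M : exp_family R p).
Implicit Types (theta : 'rV[R]_p) (x : ef_space M).

Definition partition_fun theta : \bar R :=
  \int[ef_base M]_x (ef_carrier x * expR (dotr theta (ef_stat x)))%:E.

Definition natural_space : set 'rV[R]_p :=
  [set theta | (0 < partition_fun theta < +oo)%E].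

Definition log_partition theta : R := ln (fine (partition_fun theta)).

Definition density theta x : R :=
  ef_carrier x * expR (dotr theta (ef_stat x) - log_partition theta).

(* [expect theta g] is meaningful when [integrable_under theta g] holds. *)
Definition integrable_under theta (g : ef_space M -> R) : Prop :=
  (ef_base M).-integrable setT (fun x => (g x * density theta x)%:E).

Definition expect theta (g : ef_space M -> R) : R :=
  Rintegral (ef_base M) setT (fun x => g x * density theta x).

Definition partial (i : 'I_p) (g : 'rV[R]_p -> R) : 'rV[R]_p -> R :=
  fun theta => 'D_(delta_mx ord0 i) g theta.

Definition partials (s : seq 'I_p) (g : 'rV[R]_p -> R) : 'rV[R]_p -> R :=
  foldr partial g s.

Definition score theta x (i : 'I_p) : R :=
  partial i (fun t => ln (density t x)) theta.

Definition fisher_info theta : 'M[R]_p :=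
  \matrix_(i, j) expect theta (fun x => score theta x i * score theta x j).

Definition is_argmax (Theta : set 'rV[R]_p) (F : 'rV[R]_p -> R) t : Prop :=
  Theta t /\ forall s, Theta s -> F s <= F t.

Definition mml_objective (h : 'rV[R]_p -> R) x theta : R :=
  ln (h theta) + ln (density theta x) - 2^-1 * ln (\det (fisher_info theta)).

(* A measurable choice of a maximizer over the parameter space at every data
   point where there is one; elsewhere the value is arbitrary. *)
Definition maximizes (Theta : set 'rV[R]_p)
    (obj : ef_space M -> 'rV[R]_p -> R) (est : ef_space M -> 'rV[R]_p) : Prop :=
  (forall i : 'I_p, measurable_fun setT (fun x => est x ord0 i)) /\
  (forall x, (exists t, is_argmax Theta (obj x) t) ->
     is_argmax Theta (obj x) (est x)).

Definition is_MLE (Theta : set 'rV[R]_p) (est : ef_space M -> 'rV[R]_p) :=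
  maximizes Theta (fun x theta => density theta x) est.

Definition is_MML (Theta : set 'rV[R]_p) (h : 'rV[R]_p -> R)
    (est : ef_space M -> 'rV[R]_p) :=
  maximizes Theta (mml_objective h) est.

Definition bias theta (est : ef_space M -> 'rV[R]_p) : 'rV[R]_p :=
  \row_i (expect theta (fun x => est x ord0 i) - theta ord0 i).

End Model.

Section Asymptotics.
Variables (R : realType) (p : nat) (M : nat -> exp_family R p).
Implicit Types (theta : 'rV[R]_p) (est : forall n, ef_space (M n) -> 'rV[R]_p).

(* The bias at theta is b 1 / n + ... + b m / n ^ m + o(n ^ -m); the value
   [b 0] plays no role. *)
Definition bias_expansion (m : nat) theta est (b : nat -> 'rV[R]_p) : Prop :=
  (\forall n \near \oo, forall i : 'I_p,
     integrable_under theta (fun x => est n x ord0 i)) /\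
  (fun n : nat => n%:R ^+ m *:
     (bias theta (est n) - \sum_(1 <= k < m.+1) n%:R ^- k *: b k))
    @ \oo --> (0 : 'rV[R]_p).

(* The usual regularity of the likelihood in bias expansions: information of
   exact order n at theta, and cumulants of the sufficient statistic (the
   derivatives of the log-partition function, which are up to sign those of the
   log-likelihood) of orders 2 to 4 of order n, uniformly near theta.  For an
   i.i.d. sample the log-partition function is n times that of one observation,
   so this only asks for nonsingular information. *)
Definition regular_likelihood theta : Prop :=
  (exists2 c : R, 0 < c & \forall n \near \oo, forall v : 'rV[R]_p,
     c * n%:R * dotr v v <=
     (v *m fisher_info (M n) theta *m v^T) ord0 ord0) /\
  (exists r C : R, 0 < r /\
     \forall n \near \oo, forall (s : seq 'I_p) (t : 'rV[R]_p),
       (2 <= size s <= 4)%N -> ball theta r t ->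
       `| partials s (@log_partition R p (M n)) t | <= C * n%:R).

(* The objective has a maximizer outside events of probability o(1/n). *)
Definition exists_whp (Theta : set 'rV[R]_p) theta
    (obj : forall n, ef_space (M n) -> 'rV[R]_p -> R) : Prop :=
  exists G : forall n, set (ef_space (M n)),
    [/\ forall n, measurable (G n),
        forall n x, G n x -> exists t, is_argmax Theta (obj n x) t &
        (fun n : nat => n%:R%:E *
           \int[ef_base (M n)]_(x in ~` G n) (density theta x)%:E)%E
          @ \oo --> 0%E].

(* Data whose estimate is far from theta contribute o(1/n) to the mean error;
   this is what makes a bias expansion computable from Taylor expansions
   at theta. *)
Definition negligible_tails theta est : Prop :=
  forall e : R, 0 < e ->
    (fun n : nat => n%:R%:E *
       \int[ef_base (M n)]_(x in [set x | (e < `| est n x - theta |)%R])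
         (`| est n x - theta | * density theta x)%:E)%E
      @ \oo --> 0%E.

End Asymptotics.

(* Main.v *)
Require Import Defs.
From HB Require Import structures.
From mathcomp Require Import all_boot all_order all_algebra.
From mathcomp Require Import all_classical all_reals all_analysis.
From mathcomp Require Import perm measurable_realfun ring lra.

Set Implicit Arguments.
Unset Strict Implicit.
Unset Printing Implicit Defensive.

Import Order.TTheory GRing.Theory Num.Theory numFieldNormedType.Exports.

Local Open Scope classical_set_scope.
Local Open Scope ring_scope.

(** With h proportional to the information determinant, the MML objective is, up to
a constant, ln f + (1/2) ln det I, i.e. the likelihood penalized by Jeffreys' prior
(Firth's bias reduction).  Let K be the log-partition function, S = T - grad K(theta)
the score, A = Hess K(theta) the information, u = S A^-1 and delta = mml - theta.
The stationarity equation S_l(mml) + (1/2) tr (I^-1 d_l I)(mml) = 0 and a Taylor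
expansion of grad K give
  delta = V + o(|u|^2) + O(n^-2),   V = u - (1/2) q(u^T u - A^-1) A^-1,
where q contracts a matrix with the third cumulants.  The contribution of the penalty
is exactly the A^-1 inside q, so that V has mean zero because E[u^T u] = A^-1.  The
error is integrated using E |u|^4 = O(n^-2), which follows from a second-order bound
on the cumulant generating function of S; outside the event where the expansion holds,
of probability o(1/n), the same fourth moment is combined with weighted AM-GM. *)

(** * Matrices in the sup norm, derivative of the determinant *)

(** No rate of convergence of delta is assumed; the hypotheses only say that its tails beyond any
    fixed distance e contribute o(1/n). The rate is recovered from the stationarity equation: when
    |delta| <= e with e small, the quadratic term of the expansion is absorbed by the linear one, so
    |delta| is at most a multiple of |u| + 1/n, and only moments of u are needed. The distance e
    does not shrink with n. The scaled error is at most a constant times e (1 + n^2 |u|^4) + 1/(e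
    n), so n tends to infinity first and e to 0 afterwards; for this the constants of the expansion
    must depend on p, c and C only. V is defined through u for all data, even where there is no
    maximizer. Its mean is then exactly zero, without truncation. The price is a bound for V on the
    exceptional event, where a loss of order n/e is affordable because the event has probability
    o(1/n). *)

Section MatrixNorm.
Variable R : realType.

Lemma ler_norm_coord m n (X : 'M[R]_(m, n)) i j : `|X i j| <= `|X|.
Proof.
rewrite [leRHS]/Num.norm /= mx_normrE.
by apply/bigmax_geP; right => /=; exists (i, j).
Qed.

Lemma mx_norm_le m n (X : 'M[R]_(m, n)) B :
  0 <= B -> (forall i j, `|X i j| <= B) -> `|X| <= B.
Proof.
move=> B0 XB; rewrite [leLHS]/Num.norm /= mx_normrE.
by apply/bigmax_leP; split => // -[i j] _ /=; exact: XB.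
Qed.

Lemma ler_norm_sum_const n (F : 'I_n -> R) B :
  (forall i, `|F i| <= B) -> `|\sum_(i < n) F i| <= n%:R * B.
Proof.
move=> FB; apply: le_trans (ler_norm_sum _ _ _) _.
apply: le_trans (ler_sum _ (fun i _ => FB i)) _.
by rewrite sumr_const card_ord mulr_natl.
Qed.

Lemma ler_norm_mulmx m n k (X : 'M[R]_(m, n)) (Y : 'M[R]_(n, k)) :
  `|X *m Y| <= n%:R * (`|X| * `|Y|).
Proof.
apply: mx_norm_le => [|i j]; first by rewrite mulr_ge0 ?mulr_ge0.
rewrite mxE; apply: ler_norm_sum_const => l.
by rewrite normrM ler_pM ?ler_norm_coord.
Qed.

Lemma ler_norm_trmx m n (X : 'M[R]_(m, n)) : `|X^T| <= `|X|.
Proof. by apply: mx_norm_le => // i j; rewrite mxE ler_norm_coord. Qed.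

Lemma dotrE p (u v : 'rV[R]_p) : dotr u v = (u *m v^T) ord0 ord0.
Proof. by rewrite mxE; apply: eq_bigr => i _; rewrite mxE. Qed.

Lemma ler_norm_dotr p (u v : 'rV[R]_p) : `|dotr u v| <= p%:R * (`|u| * `|v|).
Proof.
apply: ler_norm_sum_const => i.
by rewrite normrM ler_pM ?ler_norm_coord.
Qed.

Lemma sqr_norm_le_dotr p (v : 'rV[R]_p) : `|v| ^+ 2 <= dotr v v.
Proof.
have d0 : 0 <= dotr v v by apply: sumr_ge0 => i _; rewrite -expr2 sqr_ge0.
rewrite -[leRHS]sqr_sqrtr// ler_sqr ?nnegrE ?sqrtr_ge0//.
apply: mx_norm_le => [|i j]; first exact: sqrtr_ge0.
rewrite -sqrtr_sqr ler_wsqrtr// (ord1 i) /dotr (bigD1 j)//= -expr2 lerDl.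
by apply: sumr_ge0 => k _; rewrite -expr2 sqr_ge0.
Qed.

Lemma dotrDl p (u v w : 'rV[R]_p) : dotr (u + v) w = dotr u w + dotr v w.
Proof. by rewrite !dotrE mulmxDl mxE. Qed.

Lemma dotrZl p (a : R) (u v : 'rV[R]_p) : dotr (a *: u) v = a * dotr u v.
Proof. by rewrite !dotrE -scalemxAl mxE. Qed.

Lemma dotr_delta p (i : 'I_p) (v : 'rV[R]_p) :
  dotr (delta_mx ord0 i) v = v ord0 i.
Proof.
rewrite /dotr (bigD1 i)//= big1 ?addr0 => [|j ji]; first by rewrite mxE !eqxx mul1r.
by rewrite mxE eqxx (negbTE ji) mul0r.
Qed.

Lemma norm_delta_le p (i : 'I_p) : `|delta_mx ord0 i : 'rV[R]_p| <= 1.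
Proof. by apply: mx_norm_le => // a b; rewrite mxE; case: andP => _; rewrite ?normr1 ?normr0. Qed.

End MatrixNorm.

(** * Coercive quadratic forms *)

Section PositiveForm.
Variables (R : realType) (p : nat).
Implicit Types A B : 'M[R]_p.

(* [`|v|] is the sup norm, hence the factors p in what follows. *)
Definition coercive (k : R) A :=
  forall v : 'rV[R]_p, k * `|v| ^+ 2 <= (v *m A *m v^T) ord0 ord0.

(** Pair [v *m A] with [v] and divide by the norm of [v]. Both the injectivity of [A] and the bound
    on its inverse come from this. *)
Lemma coercive_mul k A (v : 'rV[R]_p) :
  0 < k -> coercive k A -> k * `|v| <= p%:R * `|v *m A|.
Proof.
move=> k0 cA; have [->|v0] := eqVneq v 0; first by rewrite mul0mx normr0 !mulr0.
have v1 : 0 < `|v| by rewrite normr_gt0.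
rewrite -(ler_pM2r v1) -mulrA -expr2; apply: le_trans (cA v) _.
rewrite -dotrE -mulrA; apply: le_trans (ler_norm _) (ler_norm_dotr _ _).
Qed.

Lemma coercive_unit k A : 0 < k -> coercive k A -> A \in unitmx.
Proof.
move=> k0 cA; rewrite -row_free_unit; apply/inj_row_free => v vA0.
have := coercive_mul v k0 cA; rewrite vA0 normr0 mulr0 pmulr_rle0// normr_le0.
by move/eqP.
Qed.

Lemma coercive_invmx_row k A (v : 'rV[R]_p) :
  0 < k -> coercive k A -> `|v *m invmx A| <= p%:R / k * `|v|.
Proof.
move=> k0 cA; have /= := coercive_mul (v *m invmx A) k0 cA.
by rewrite mulmxKV ?(coercive_unit k0)// mulrAC ler_pdivlMr// mulrC.
Qed.

Lemma coercive_invmx k A : 0 < k -> coercive k A -> `|invmx A| <= p%:R / k.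
Proof.
move=> k0 cA; apply: mx_norm_le => [|i j]; first by rewrite divr_ge0// ltW.
have -> : invmx A i j = ((delta_mx ord0 i : 'rV_p) *m invmx A) ord0 j by rewrite -rowE mxE.
apply: le_trans (ler_norm_coord _ _ _) _.
apply: le_trans (coercive_invmx_row _ k0 cA) _.
by rewrite ler_piMr ?norm_delta_le// divr_ge0// ltW.
Qed.

(* The determinant does not vanish along the segment from the identity. *)
Lemma coercive_det_gt0 k A : 0 < k -> coercive k A -> 0 < \det A.
Proof.
move=> k0 cA; rewrite ltNge; apply/negP => dA.
pose P : {poly R} := \det ((1 - 'X) *: 1%:M + 'X *: map_mx polyC A).
have PE s : P.[s] = \det ((1 - s) *: 1%:M + s *: A).
  rewrite /P -[LHS]/(horner_eval s _) -det_map_mx; congr (\det _).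
  apply/matrixP => i j; rewrite !mxE -[LHS]/(_.[s]).
  by case: (i == j); rewrite !hornerE.
(* The determinant is 1 at 0 and nonpositive at 1, while [poly_ivt] expects values rising through
   zero; hence [- P]. *)
have [||s /andP[s0 s1] /rootP] := @poly_ivt _ (- P) 0 1; first by [].
- rewrite !hornerN !PE subr0 scale1r scale0r addr0 det1 subrr scale0r add0r.
  by rewrite scale1r oppr_le0 ler01 oppr_ge0 dA.
rewrite hornerN PE => /eqP; rewrite oppr_eq0 => /eqP Ps.
pose B := (1 - s) *: 1%:M + s *: A.
(* Both ends of the segment are coercive with constant [Num.min 1 k], and convex combinations keep
   it, so no matrix in between is singular. *)
have B0 : 0 < Num.min 1 k by rewrite lt_min ltr01.
suff cB : coercive (Num.min 1 k) B.
  by have := coercive_unit B0 cB; rewrite unitmxE Ps unitr0.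
move=> v; rewrite /B mulmxDr mulmxDl -!scalemxAr -!scalemxAl mulmx1.
have -> : ((1 - s) *: (v *m v^T) + s *: (v *m A *m v^T)) ord0 ord0 =
   (1 - s) * dotr v v + s * (v *m A *m v^T) ord0 ord0 by rewrite dotrE !mxE.
have -> : Num.min 1 k * `|v| ^+ 2 =
  (1 - s) * (Num.min 1 k * `|v| ^+ 2) + s * (Num.min 1 k * `|v| ^+ 2) by ring.
have v0 : 0 <= `|v| ^+ 2 by rewrite exprn_ge0.
apply: lerD; apply: ler_wpM2l; rewrite ?subr_ge0//.
  by apply: le_trans (sqr_norm_le_dotr v); rewrite ler_piMl// ge_min lexx.
by apply: le_trans (cA v); rewrite ler_wpM2r// ge_min lexx orbT.
Qed.

(** In the sup norm each of the two products in the form costs a factor [p], hence [p ^ 2]; half of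
    the constant is given up to the perturbation. *)
Lemma coercive_perturb k A B : coercive k A ->
  p%:R ^+ 2 * `|A - B| <= k / 2 -> coercive (k / 2) B.
Proof.
move=> cA AB v.
have -> : v *m B *m v^T = v *m A *m v^T - v *m (A - B) *m v^T.
  by rewrite -mulmxBl -mulmxBr opprB addrC subrK.
rewrite [leRHS]mxE [X in _ + X]mxE lerBrDr; apply: le_trans (cA v).
have -> : k * `|v| ^+ 2 = k / 2 * `|v| ^+ 2 + k / 2 * `|v| ^+ 2 by field.
rewrite lerD2l; apply: le_trans (ler_norm _) _.
apply: le_trans (ler_norm_coord _ _ _) _.
apply: le_trans (ler_norm_mulmx _ _) _.
have -> : k / 2 * `|v| ^+ 2 = k / 2 * `|v| * `|v| by ring.
apply: le_trans (_ : p%:R * (p%:R * (`|v| * `|A - B|)) * `|v| <= _).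
  by rewrite mulrA ler_pM ?mulr_ge0// ?ler_norm_trmx// ler_wpM2l// ler_norm_mulmx.
rewrite ler_wpM2r//.
have -> : p%:R * (p%:R * (`|v| * `|A - B|)) = p%:R ^+ 2 * `|A - B| * `|v| by ring.
by rewrite ler_wpM2r.
Qed.

(** Resolvent identity: it carries Lipschitz bounds over from a matrix to its inverse. *)
Lemma invmxB A B : A \in unitmx -> B \in unitmx ->
  invmx B - invmx A = invmx B *m (A - B) *m invmx A.
Proof.
by move=> uA uB; rewrite mulmxBr mulmxBl mulmxK// mulVmx// mul1mx.
Qed.

End PositiveForm.

(** * Jacobi's formula *)

Section DetDerivative.
Variable R : realType.

Lemma is_derive_bigsum (V : normedModType R) (I : Type) (r : seq I)
    (f : I -> V -> R) (df : I -> R) (x v : V) :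
  (forall i, is_derive x v (f i) (df i)) ->
  is_derive x v (fun y => \sum_(i <- r) f i y) (\sum_(i <- r) df i).
Proof.
move=> dF; elim: r => [|i r IH].
  rewrite big_nil (_ : (fun _ => _) = cst 0); first exact: is_derive_cst.
  by apply/funext => y; rewrite big_nil.
rewrite big_cons (_ : (fun _ => _) = f i + (fun y => \sum_(j <- r) f j y)).
  exact: is_deriveD.
by apply/funext => y; rewrite big_cons.
Qed.

Lemma is_derive_prod n (f : 'I_n -> R -> R) (df : 'I_n -> R) (s : R) :
  (forall i, is_derive s 1 (f i) (df i)) ->
  is_derive s 1 (fun x => \prod_i f i x)
    (\sum_i df i * \prod_(j | i != j) f j s).
Proof.
elim: n f df => [|n IH] f df dF.
  rewrite big_ord0 (_ : (fun _ => _) = cst 1); first exact: is_derive_cst.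
  by apply/funext => x; rewrite big_ord0.
rewrite (_ : (fun _ => _) = f ord0 * (fun x => \prod_i f (lift ord0 i) x)); last first.
  by apply/funext => x; rewrite big_ord_recl.
have dG := IH (fun i => f (lift ord0 i)) _ (fun i => dF (lift ord0 i)).
apply: is_derive_eq (is_deriveM (dF ord0) dG) _.
rewrite big_ord_recl addrC; congr (_ + _).
  rewrite -[LHS]/(_ * _) mulrC; congr (_ * _).
  rewrite [RHS]big_mkcond big_ord_recl eqxx /= mul1r.
  by apply: eq_bigr => i _; rewrite ?neq_lift.
rewrite scaler_sumr; apply: eq_bigr => i _ /=.
rewrite [in RHS]big_mkcond big_ord_recl /=.
rewrite -[f ord0 s *: _]/(f ord0 s * _) mulrCA; congr (_ * (_ * _)).
rewrite big_mkcond; apply: eq_bigr => j _.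
by rewrite (inj_eq lift_inj).
Qed.

Lemma is_derive_det n (A : R -> 'M[R]_n) (dA : 'M[R]_n) (s : R) :
  (forall i j, is_derive s 1 (fun x => A x i j) (dA i j)) ->
  is_derive s 1 (fun x => \det (A x)) (\sum_i \sum_j dA i j * cofactor (A s) i j).
Proof.
move=> dAij.
have H (t : 'S_n) : is_derive s 1 (fun x => (-1) ^+ t * \prod_i A x i (t i))
   ((-1) ^+ t * \sum_i dA i (t i) * \prod_(j | i != j) A s j (t j)).
  by apply: is_deriveZ; apply: is_derive_prod => i; exact: dAij.
apply: is_derive_eq (is_derive_bigsum _ H) _.
under eq_bigr do rewrite mulr_sumr.
rewrite exchange_big; apply: eq_bigr => i _ /=.
(* Grouping the permutations by the image [j] of [i] makes each group the expansion of one
   cofactor. *)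
rewrite (partition_big (fun t : 'S_n => t i) predT)//=.
apply: eq_bigr => j _; rewrite expand_cofactor mulr_sumr.
by apply: eq_bigr => t /eqP ti; rewrite ti mulrCA.
Qed.

(** The inverse is the transposed cofactor matrix over the determinant, which explains the swapped
    indices of [dA]. *)
Lemma is_derive_ln_det n (A : R -> 'M[R]_n) (dA : 'M[R]_n) (s : R) :
  (forall i j, is_derive s 1 (fun x => A x i j) (dA i j)) ->
  0 < \det (A s) ->
  is_derive s 1 (fun x => ln (\det (A x)))
    (\sum_i \sum_j invmx (A s) i j * dA j i).
Proof.
move=> dAij dt0.
apply: is_derive_eq (is_derive1_comp (is_derive1_ln dt0) (is_derive_det dAij)) _.
have uA : A s \in unitmx by rewrite unitmxE unitfE gt_eqF.
rewrite mulr_sumr [RHS]exchange_big; apply: eq_bigr => i _ /=.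
rewrite mulr_sumr; apply: eq_bigr => j _.
by rewrite /invmx uA !mxE [dA i j * _]mulrC mulrA.
Qed.

End DetDerivative.

(** * Taylor expansion along gradients *)

Section Taylor1D.
Variable R : realType.
Implicit Types f df : R -> R.

Lemma increment_le f df B :
  (forall s : R, 0 <= s <= 1 -> is_derive s 1 f (df s)) ->
  (forall s : R, 0 <= s <= 1 -> `|df s| <= B) ->
  forall s : R, 0 <= s <= 1 -> `|f s - f 0| <= B.
Proof.
move=> dF dfB s /andP[s0 s1].
have inI x : x \in `[0, s] -> 0 <= x <= 1.
  by rewrite in_itv /= => /andP[-> /le_trans ->].
have [x||x xs ->] := @MVT_segment R f df 0 s s0.
- by rewrite in_itv /= => /andP[x0 xs]; apply: dF; rewrite ltW//= (le_trans (ltW xs)).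
- by apply: derivable_within_continuous => x /inI /dF [].
rewrite subr0 normrM (ger0_norm s0).
have xB := dfB _ (inI _ xs).
by rewrite -[leRHS]mulr1 ler_pM.
Qed.

(** Subtracting the top Taylor term reduces each order to the previous one. The factorials of the
    sharp remainder are given up, since only orders of magnitude matter. *)
Lemma taylor2_le f f1 f2 B :
  (forall s : R, 0 <= s <= 1 -> is_derive s 1 f (f1 s)) ->
  (forall s : R, 0 <= s <= 1 -> is_derive s 1 f1 (f2 s)) ->
  (forall s : R, 0 <= s <= 1 -> `|f2 s| <= B) ->
  `|f 1 - f 0 - f1 0| <= B.
Proof.
move=> d1 d2 B2.
pose F x := f x - f1 0 * x.
have -> : f 1 - f 0 - f1 0 = F 1 - F 0 by rewrite /F; ring.
apply: (@increment_le F (fun x => f1 x - f1 0)); last by rewrite lexx ler01.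
  move=> s /d1 ds.
  have H : is_derive s 1 (f - (f1 0 \*: id)) (f1 s - (f1 0 *: 1)).
    by apply: is_deriveB; apply: is_deriveZ.
  by apply: is_derive_eq H _; rewrite -[X in _ - X = _]/(f1 0 * 1) mulr1.
exact: increment_le d2 B2.
Qed.

Lemma taylor3_le f f1 f2 f3 B :
  (forall s : R, 0 <= s <= 1 -> is_derive s 1 f (f1 s)) ->
  (forall s : R, 0 <= s <= 1 -> is_derive s 1 f1 (f2 s)) ->
  (forall s : R, 0 <= s <= 1 -> is_derive s 1 f2 (f3 s)) ->
  (forall s : R, 0 <= s <= 1 -> `|f3 s| <= B) ->
  `|f 1 - f 0 - f1 0 - 2^-1 * f2 0| <= B.
Proof.
move=> d1 d2 d3 B3.
pose F x := f x - 2^-1 * f2 0 * x ^+ 2.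
have -> : f 1 - f 0 - f1 0 - 2^-1 * f2 0 = F 1 - F 0 - (f1 0 - f2 0 * 0).
  by rewrite /F; ring.
apply: (@taylor2_le F (fun x => f1 x - f2 0 * x) (fun x => f2 x - f2 0)) => s sI.
  have ds := d1 _ sI.
  have H : is_derive s 1 (f - ((2^-1 * f2 0) \*: (id ^+ 2)))
    (f1 s - ((2^-1 * f2 0) *: ((2%:R * s ^+ 1) *: 1))).
    by apply: is_deriveB; apply: is_deriveZ.
  apply: is_derive_eq H _.
  rewrite -[_ *: (_ *: _)]/(2^-1 * f2 0 * (2 * s ^+ 1 * 1)).
  by field.
  have ds := d2 _ sI.
  have H : is_derive s 1 (f1 - (f2 0 \*: id)) (f2 s - (f2 0 *: 1)).
    by apply: is_deriveB; apply: is_deriveZ.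
  by apply: is_derive_eq H _; rewrite -[X in _ - X = _]/(f2 0 * 1) mulr1.
exact: increment_le d3 B3 _ sI.
Qed.

End Taylor1D.

Section Gradient.
Variables (R : realType) (p : nat).
Local Notation V := 'rV[R]_p.
Implicit Types (D : set V) (f : V -> R) (g : 'I_p -> V -> R).

Lemma is_derive_line f (t v : V) (s df : R) :
  is_derive (t + s *: v) v f df -> is_derive s 1 (fun x : R => f (t + x *: v)) df.
Proof.
have E : (fun h : R => h^-1 *: (((fun x : R => f (t + x *: v)) \o shift s) (h *: 1) -
    f (t + s *: v))) =
  (fun h : R => h^-1 *: ((f \o shift (t + s *: v)) (h *: v) - f (t + s *: v))).
  apply/funext => h /=; congr (_ *: (f _ - _)).
  by rewrite -[h *: 1]/(h * 1) mulr1 scalerDl addrCA.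
move=> [fv <-]; split; first by rewrite /derivable E.
by rewrite /derive E.
Qed.

Lemma line_is_derive f (t v : V) (df : R) :
  is_derive (0 : R) 1 (fun x : R => f (t + x *: v)) df -> is_derive t v f df.
Proof.
have E : (fun h : R => h^-1 *: (((fun x : R => f (t + x *: v)) \o shift 0) (h *: 1) -
    f (t + 0 *: v))) =
  (fun h : R => h^-1 *: ((f \o shift t) (h *: v) - f t)).
  apply/funext => h /=.
  by rewrite -[h *: 1]/(h * 1) mulr1 scale0r !addr0 [h *: v + t]addrC.
by move=> [+ <-]; rewrite /derivable /derive E => fv; split.
Qed.

(* Gateaux differentiability with a derivative linear in the direction: all that
   Taylor expansions along segments need. *)
Definition has_grad D f g := forall t, D t -> forall v : V,
  is_derive t v f (\sum_i v ord0 i * g i t).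

(** The recursion on the order lets closure under sums, products, inverses and logarithms follow by
    induction from one gradient rule each. *)
Fixpoint smooth D (n : nat) f : Prop :=
  if n is m.+1 then exists2 g, has_grad D f g & forall i, smooth D m (g i)
  else True.

Lemma has_grad_ext D f f' g : open D -> {in D, f =1 f'} ->
  has_grad D f g -> has_grad D f' g.
Proof.
move=> oD ff' dF t Dt v; apply: near_eq_is_derive (dF t Dt v).
by move: (oD _ Dt); apply: filterS => y Dy; apply: ff'; rewrite inE.
Qed.

Lemma smooth_ext D n f f' : open D -> {in D, f =1 f'} ->
  smooth D n f -> smooth D n f'.
Proof.
case: n => //= n oD ff' [g dF sg]; exists g => //; exact: has_grad_ext dF.
Qed.

Lemma smoothW D n f : smooth D n.+1 f -> smooth D n f.
Proof.
elim: n f => // n IH f [g dF sg]; exists g => // i; exact/IH/sg.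
Qed.

Lemma has_grad_partial D f g i t : has_grad D f g -> D t -> partial i f t = g i t.
Proof.
move=> dF Dt; rewrite /partial; have [_ ->] := dF t Dt (delta_mx ord0 i).
have -> : g i t = (\row_j g j t) ord0 i by rewrite mxE.
by rewrite -dotr_delta; apply: eq_bigr => j _; rewrite [in RHS]mxE.
Qed.

Lemma smooth_has_grad D n f : open D -> smooth D n.+1 f ->
  has_grad D f (fun i => partial i f).
Proof.
move=> oD [g dF _] t Dt v; apply: is_derive_eq (dF t Dt v) _.
by apply: eq_bigr => i _; rewrite (has_grad_partial _ dF).
Qed.

Lemma smooth_partial D n f i : open D -> smooth D n.+1 f -> smooth D n (partial i f).
Proof.
move=> oD [g dF sg]; apply: smooth_ext (sg i) => // t; rewrite inE => Dt.
by rewrite (has_grad_partial _ dF).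
Qed.

Lemma smooth_partials D f s : open D ->
  (forall n, smooth D n f) -> forall n, smooth D n (partials s f).
Proof. by move=> oD sf; elim: s => //= i s IH n; apply: smooth_partial. Qed.

Lemma has_gradD D f1 f2 g1 g2 : has_grad D f1 g1 -> has_grad D f2 g2 ->
  has_grad D (fun t => f1 t + f2 t) (fun i t => g1 i t + g2 i t).
Proof.
move=> d1 d2 t Dt v; apply: is_derive_eq (is_deriveD (d1 t Dt v) (d2 t Dt v)) _.
by rewrite -big_split; apply: eq_bigr => i _; rewrite mulrDr.
Qed.

Lemma has_gradN D f g : has_grad D f g ->
  has_grad D (fun t => - f t) (fun i t => - g i t).
Proof.
move=> dF t Dt v; apply: is_derive_eq (is_deriveN (dF t Dt v)) _.
by rewrite -sumrN; apply: eq_bigr => i _; rewrite mulrN.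
Qed.

Lemma has_gradM D f1 f2 g1 g2 : has_grad D f1 g1 -> has_grad D f2 g2 ->
  has_grad D (fun t => f1 t * f2 t) (fun i t => f1 t * g2 i t + g1 i t * f2 t).
Proof.
move=> d1 d2 t Dt v; apply: is_derive_eq (is_deriveM (d1 t Dt v) (d2 t Dt v)) _.
rewrite -[f1 t *: _]/(_ * _) -[f2 t *: _]/(_ * _) !mulr_sumr -big_split.
by apply: eq_bigr => i _ /=; rewrite mulrDr mulrCA [f2 t * _]mulrC -[in LHS]mulrA.
Qed.

(** As only directional derivatives are required, the chain rule in one variable, applied on each
    line, is enough. *)
Lemma has_grad_comp D f g (phi dphi : R -> R) : has_grad D f g ->
  (forall t, D t -> is_derive (f t) 1 phi (dphi (f t))) ->
  has_grad D (fun t => phi (f t)) (fun i t => dphi (f t) * g i t).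
Proof.
move=> dF dphiP t Dt v; apply: line_is_derive.
have d1 : is_derive (0 : R) 1 (fun x : R => f (t + x *: v)) (\sum_i v ord0 i * g i t).
  by apply: is_derive_line; rewrite scale0r addr0; exact: dF.
have d2 : is_derive (f (t + 0 *: v)) 1 phi (dphi (f t)).
  by rewrite scale0r addr0; exact: dphiP.
apply: is_derive_eq (is_derive1_comp d2 d1) _.
by rewrite mulr_sumr; apply: eq_bigr => i _; rewrite mulrCA.
Qed.

Lemma smoothD D n f1 f2 : smooth D n f1 -> smooth D n f2 ->
  smooth D n (fun t => f1 t + f2 t).
Proof.
elim: n f1 f2 => //= n IH f1 f2 [g1 d1 s1] [g2 d2 s2].
by eexists; [exact: has_gradD d1 d2|move=> i; exact: IH].
Qed.

Lemma smoothN D n f : smooth D n f -> smooth D n (fun t => - f t).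
Proof.
elim: n f => //= n IH f [g d s].
by eexists; [exact: has_gradN d|move=> i; exact: IH].
Qed.

Lemma smoothM D n f1 f2 : smooth D n f1 -> smooth D n f2 ->
  smooth D n (fun t => f1 t * f2 t).
Proof.
elim: n f1 f2 => // n IH f1 f2 S1 S2; have /smoothW T1 := S1; have /smoothW T2 := S2.
case: S1 S2 => [g1 d1 s1] [g2 d2 s2].
eexists; [exact: has_gradM d1 d2|].
move=> i; apply: smoothD; [exact: (IH _ _ T1 (s2 i))|exact: (IH _ _ (s1 i) T2)].
Qed.

(** The derivative of 1/f contains 1/f again, so smoothness of the inverse at one order feeds the
    next. *)
Lemma smoothV D n f : (forall t, D t -> f t != 0) -> smooth D n f ->
  smooth D n (fun t => (f t)^-1).
Proof.
move=> f0; elim: n => // n IH S1; have /smoothW T0 := S1; have T1 := IH T0.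
case: S1 => [g d s]; eexists.
  apply: (@has_grad_comp _ _ _ GRing.inv (fun x => - (x^-1 * x^-1))) d _ => t Dt.
  apply: trigger_derive (@is_deriveV R id (f t) 1 1 (f0 _ Dt) _) _.
  by rewrite -[LHS]/(- _ * 1) mulr1 -invfM -expr2.
by move=> i; apply: smoothM (s i); apply: smoothN; apply: smoothM.
Qed.

Lemma smooth_ln D n f : (forall t, D t -> 0 < f t) -> smooth D n f ->
  smooth D n (fun t => ln (f t)).
Proof.
move=> f0; case: n => // n S1; have /smoothW T1 := S1.
case: S1 => [g d s]; eexists.
  by apply: (@has_grad_comp _ _ _ (@ln R) (fun x => x^-1)) d _ => t Dt; exact: is_derive1_ln (f0 _ Dt).
by move=> i; apply: smoothM (s i); apply: smoothV T1 => t /f0 /gt_eqF ->.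
Qed.

Section TaylorBall.
Variables (D : set V) (t v : V).
Hypothesis seg : forall s : R, 0 <= s <= 1 -> D (t + s *: v).

Let line f x := f (t + x *: v).

Let line0 f : line f 0 = f t. Proof. by rewrite /line scale0r addr0. Qed.
Let line1 f : line f 1 = f (t + v). Proof. by rewrite /line scale1r. Qed.

Let dline f g (s : R) : has_grad D f g -> 0 <= s <= 1 ->
  is_derive s 1 (line f) (\sum_i v ord0 i * line (g i) s).
Proof. by move=> dF s01; apply: is_derive_line; apply: dF; exact: seg. Qed.

Let ler_norm_lin (F : 'I_p -> R) (B : R) : (forall i, `|F i| <= B) ->
  `|\sum_i v ord0 i * F i| <= p%:R * `|v| * B.
Proof.
move=> FB; rewrite -mulrA; apply: ler_norm_sum_const => i.
by rewrite normrM ler_pM// ler_norm_coord.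
Qed.

Lemma grad_lipschitz f g B : has_grad D f g ->
  (forall i x, D x -> `|g i x| <= B) -> `|f (t + v) - f t| <= p%:R * `|v| * B.
Proof.
move=> dF gB; rewrite -line0 -line1.
apply: (increment_le (df := fun s => \sum_i v ord0 i * line (g i) s)); last by rewrite lexx ler01.
  by move=> s; exact: dline.
by move=> s s01; apply: ler_norm_lin => i; apply: gB; exact: seg.
Qed.

Let dline2 (g : 'I_p -> V -> R) (h : 'I_p -> 'I_p -> V -> R) (s : R) :
  (forall i, has_grad D (g i) (h i)) -> 0 <= s <= 1 ->
  is_derive s 1 (fun s => \sum_i v ord0 i * line (g i) s)
    (\sum_i v ord0 i * \sum_j v ord0 j * line (h i j) s).
Proof.
move=> dg s01; apply: is_derive_bigsum => i.
by apply: is_deriveZ; exact: dline.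
Qed.

Lemma grad_taylor2 f g h B : has_grad D f g -> (forall i, has_grad D (g i) (h i)) ->
  (forall i j x, D x -> `|h i j x| <= B) ->
  `|f (t + v) - f t - \sum_i v ord0 i * g i t| <= (p%:R * `|v|) ^+ 2 * B.
Proof.
move=> dF dg hB; rewrite -line0 -line1.
under eq_bigr do rewrite -line0.
apply: (taylor2_le (f1 := fun s => \sum_i v ord0 i * line (g i) s)).
- by move=> s; exact: dline.
- by move=> s; exact: dline2.
move=> s s01; rewrite expr2 -mulrA; apply: ler_norm_lin => i; apply: ler_norm_lin => j.
by apply: hB; exact: seg.
Qed.

Lemma grad_taylor3 f g h k B : has_grad D f g -> (forall i, has_grad D (g i) (h i)) ->
  (forall i j, has_grad D (h i j) (k i j)) ->
  (forall i j l x, D x -> `|k i j l x| <= B) ->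
  `|f (t + v) - f t - \sum_i v ord0 i * g i t -
     2^-1 * \sum_i v ord0 i * \sum_j v ord0 j * h i j t| <= (p%:R * `|v|) ^+ 3 * B.
Proof.
move=> dF dg dh kB; rewrite -line0 -line1.
under eq_bigr do rewrite -line0.
under [X in _ * X]eq_bigr do under eq_bigr do rewrite -line0.
apply: (taylor3_le (f1 := fun s => \sum_i v ord0 i * line (g i) s)
  (f2 := fun s => \sum_i v ord0 i * \sum_j v ord0 j * line (h i j) s)
  (f3 := fun s => \sum_i v ord0 i * \sum_j v ord0 j * \sum_l v ord0 l * line (k i j l) s)).
- by move=> s; exact: dline.
- by move=> s; exact: dline2.
- move=> s s01; apply: is_derive_bigsum => i; apply: is_deriveZ.
  by apply: is_derive_bigsum => j; apply: is_deriveZ; exact: dline.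
move=> s s01; rewrite exprS -mulrA; apply: ler_norm_lin => i.
rewrite exprS -mulrA; apply: ler_norm_lin => j; rewrite expr1; apply: ler_norm_lin => l.
by apply: kB; exact: seg.
Qed.

End TaylorBall.
End Gradient.

(** * Differentiation of the moments under the integral *)

(** Raise z <= exp z, at z = a y / (k + 1), to the power k; the leftover factor k / (k + 1) in the
    exponent is at most 1. Taking k + 1 instead of k covers k = 0. *)
Lemma poly_le_exp (R : realType) (k : nat) (a y : R) : 0 < a -> 0 <= y ->
  y ^+ k <= (k.+1%:R / a) ^+ k * expR (a * y).
Proof.
move=> a0 y0; pose b := k.+1%:R / a.
have b0 : 0 < b by rewrite divr_gt0.
have yb : y <= b * expR (y / b).
  rewrite -ler_pdivrMl// mulrC; apply: le_trans (expR_ge1Dx _).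
  by rewrite lerDr.
have H : y ^+ k <= (b * expR (y / b)) ^+ k.
  by apply: lerXn2r => //; rewrite nnegrE mulr_ge0 ?expR_ge0// ltW.
have bk : 0 <= b ^+ k by rewrite exprn_ge0// ltW.
apply: le_trans H _; rewrite exprMn; apply: ler_wpM2l => //.
rewrite -expRM_natl ler_expR.
have -> : k%:R * (y / b) = (k%:R / k.+1%:R) * (a * y).
  by rewrite /b invf_div; ring.
have ay : 0 <= a * y by rewrite mulr_ge0// ltW.
by rewrite ler_piMl// ler_pdivrMr// mul1r ler_nat.
Qed.

Section Moments.
Variables (R : realType) (p : nat) (M : exp_family R p).
Local Notation mu := (ef_base M).
Local Notation T := (@ef_stat R p M).
Implicit Types (t v : 'rV[R]_p) (x : ef_space M) (s : seq 'I_p).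

Definition weight t x : R := ef_carrier x * expR (dotr t (T x)).
(** Indexing by a list turns differentiation of a moment in coordinate [i] into prepending [i]. *)
Definition monomial s x : R := \prod_(i <- s) T x ord0 i.
Definition moment s t : R := Rintegral mu setT (fun x => monomial s x * weight t x).

Lemma weight_ge0 t x : 0 <= weight t x.
Proof. by rewrite mulr_ge0 ?ef_carrier_ge0 ?expR_ge0. Qed.

Lemma measurable_dotr t : measurable_fun setT (fun x => dotr t (T x)).
Proof.
apply: measurable_sum => i; apply: measurable_funM; first exact: measurable_cst.
exact: ef_stat_measurable.
Qed.

Lemma measurable_weight t : measurable_fun setT (weight t).
Proof.
apply: measurable_funM; first exact: ef_carrier_measurable.
by apply: measurableT_comp => //; exact: measurable_dotr.
Qed.

Lemma measurable_monomial s : measurable_fun setT (monomial s).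
Proof.
apply: measurable_prod => i _; exact: ef_stat_measurable.
Qed.

Lemma integrable_weight t : natural_space M t ->
  mu.-integrable setT (EFin \o weight t).
Proof.
move=> /= /andP[_ Zoo]; apply/integrableP; split.
  by apply/measurable_EFinP; exact: measurable_weight.
apply: le_lt_trans Zoo; rewrite le_eqVlt; apply/orP; left; apply/eqP.
by apply: eq_integral => x _ /=; rewrite ger0_norm// weight_ge0.
Qed.

Lemma norm_monomial_le s x : `|monomial s x| <= `|T x| ^+ size s.
Proof.
elim: s => [|i s IH]; first by rewrite /monomial big_nil normr1.
by rewrite /monomial big_cons normrM exprS ler_pM// ler_norm_coord.
Qed.

(** The sup norm is attained at some coordinate, and an exponential of an absolute value is at most
    the sum of the two signed exponentials, which are weights at shifted parameters. The isolated
    [weight t x] serves the case of zero norm. *)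
Lemma exp_norm_le (a : R) t x : 0 <= a ->
  weight t x * expR (a * `|T x|) <= weight t x +
  \sum_i (weight (t + a *: delta_mx ord0 i) x + weight (t - a *: delta_mx ord0 i) x).
Proof.
move=> a0.
have W (b : R) i : weight (t + b *: delta_mx ord0 i) x = weight t x * expR (b * T x ord0 i).
  by rewrite /weight dotrDl dotrZl dotr_delta expRD mulrA.
have pos i : 0 <= weight (t + a *: delta_mx ord0 i) x + weight (t - a *: delta_mx ord0 i) x.
  by rewrite addr_ge0 ?weight_ge0.
have [T0|] := eqVneq (mx_norm (T x)) 0.
  rewrite [`|_|]T0 mulr0 expR0 mulr1 lerDl; exact: sumr_ge0.
move=> /mx_norm_neq0[[j i]]; rewrite (ord1 j) /= => Ti.
rewrite (bigD1 i)//= [`|T x|]Ti addrCA; apply: ler_wpDr.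
  by rewrite addr_ge0 ?weight_ge0//; exact: sumr_ge0.
rewrite -scaleNr !W -mulrDr ler_wpM2l ?weight_ge0//.
have [Ti0|Ti0] := leP 0 (T x ord0 i).
  by rewrite ger0_norm// lerDl expR_ge0.
by rewrite ltr0_norm// mulrN mulNr lerDr expR_ge0.
Qed.

Section Dominated.
Variable Theta : set 'rV[R]_p.
Hypotheses (Theta_open : open Theta) (Theta_nat : Theta `<=` natural_space M).

(** Of the exponential moment exp(a |T|), available because the shifted parameters stay in [Theta],
    one half of the exponent absorbs the monomial and the other half the displacement from [t0] to
    [t]. The radius does not depend on [s]. *)
Lemma monomial_weight_dominated t0 : Theta t0 -> exists2 r : R, 0 < r &
  forall s, exists G : ef_space M -> R, [/\ forall x, 0 <= G x,
    mu.-integrable setT (EFin \o G) &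
    forall t x, `|t - t0| <= r -> `|monomial s x * weight t x| <= G x].
Proof.
move=> Th0; have /nbhs_ballP[e /= e0 eT] := Theta_open Th0.
pose a := e / 2.
have a0 : 0 < a by rewrite divr_gt0.
have Da i (b : R) : `|b| = a -> Theta (t0 + b *: delta_mx ord0 i).
  move=> ba; apply: eT; rewrite mx_norm_ball /ball_ /= opprD addNKr normrN normrZ ba.
  apply: le_lt_trans (_ : a * 1 < e); first by rewrite ler_wpM2l ?norm_delta_le// ltW.
  by rewrite mulr1 /a ltr_pdivrMr// ltr_pMr// ltr1n.
(* Chosen so that p r <= a / 2, the exponent reserved for the displacement; [p.+1] keeps the divisor
   nonzero. *)
pose r := a / 2 / p.+1%:R.
exists r; first by rewrite !divr_gt0.
move=> s; set k := size s.
pose D x := weight t0 x + \sum_i (weight (t0 + a *: delta_mx ord0 i) x + weight (t0 - a *: delta_mx ord0 i) x).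
have D0 x : 0 <= D x by rewrite addr_ge0 ?weight_ge0//; apply: sumr_ge0 => i _; rewrite addr_ge0 ?weight_ge0.
exists (fun x => (k.+1%:R / (a / 2)) ^+ k * D x); split.
- by move=> x; rewrite mulr_ge0// exprn_ge0// !divr_ge0// ltW.
- rewrite /comp; under eq_fun do rewrite EFinM.
  apply: integrableZl => //; rewrite /D.
  under eq_fun do rewrite EFinD -sumEFin.
  apply: integrableD => //; first by apply: integrable_weight; exact: Theta_nat.
  apply: integrable_sum => // i _.
  under eq_fun do rewrite EFinD.
  apply: integrableD => //; apply: integrable_weight; apply: Theta_nat.
    by apply: Da; rewrite gtr0_norm.
  by rewrite -scaleNr; apply: Da; rewrite normrN gtr0_norm.
move=> t x tr.
rewrite normrM (ger0_norm (weight_ge0 _ _)).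
apply: le_trans (ler_wpM2r (weight_ge0 _ _) (norm_monomial_le _ _)) _.
have a20 : 0 < a / 2 by rewrite divr_gt0.
have := @poly_le_exp R k (a / 2) `|T x| a20 (normr_ge0 _).
move/(ler_wpM2l (weight_ge0 t x)); rewrite mulrC => /le_trans; apply.
rewrite mulrCA; apply: ler_wpM2l; first by rewrite exprn_ge0// divr_ge0// ltW.
apply: le_trans (exp_norm_le _ _ (ltW a0)).
have -> : weight t x = weight t0 x * expR (dotr (t - t0) (T x)).
  by rewrite /weight -mulrA -expRD -dotrDl [t0 + _]addrC subrK.
rewrite -mulrA; apply: ler_wpM2l; rewrite ?weight_ge0// -expRD ler_expR.
have -> : a * `|T x| = a / 2 * `|T x| + a / 2 * `|T x| by field.
rewrite lerD2r; apply: le_trans (ler_norm _) _; apply: le_trans (ler_norm_dotr _ _) _.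
rewrite mulrA ler_wpM2r//.
apply: le_trans (_ : p.+1%:R * r <= _); first by rewrite ler_pM// ler_nat.
by rewrite /r mulrC divfK.
Qed.

Lemma integrable_monomial s t : Theta t ->
  mu.-integrable setT (EFin \o (fun x => monomial s x * weight t x)).
Proof.
move=> Tt; have [r r0 /(_ s)[G [G0 iG GB]]] := monomial_weight_dominated Tt.
apply: le_integrable iG => //.
  apply/measurable_EFinP; apply: measurable_funM; first exact: measurable_monomial.
  exact: measurable_weight.
move=> x _ /=; rewrite lee_fin (ger0_norm (G0 x)); apply: GB.
by rewrite subrr normr0 ltW.
Qed.

(** On a fixed line this is differentiation under the integral in one real variable, dominated by
    the envelopes of the monomials [i :: s]. *)
Lemma has_grad_moment s : has_grad Theta (moment s) (fun i => moment (i :: s)).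
Proof.
move=> t Tt v; have [r r0 dom] := monomial_weight_dominated Tt.
(* For parameters below [r'] the line stays both in [Theta] and within the radius of domination;
   [|v| + 1] allows [v = 0]. *)
have [r' r'0 r'v] : exists2 r' : R, 0 < r' &
    forall h : R, `|h| < r' -> Theta (t + h *: v) /\ `|t + h *: v - t| <= r.
  have /nbhs_ballP[e /= e0 eT] := Theta_open Tt.
  have v1 : 0 < `|v| + 1 by rewrite ltr_wpDl.
  exists (Num.min e r / (`|v| + 1)); first by rewrite divr_gt0// lt_min e0.
  move=> h hr; have hv : `|h *: v| < Num.min e r.
    rewrite normrZ; apply: le_lt_trans (_ : `|h| * (`|v| + 1) < _).
      by rewrite ler_wpM2l// lerDl.
    by rewrite -ltr_pdivlMr.
  split; last by rewrite addrAC subrr add0r ltW// (lt_le_trans hv)// ge_min lexx orbT.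
  apply: eT; rewrite mx_norm_ball /ball_ /= opprD addNKr normrN.
  by rewrite (lt_le_trans hv)// ge_min lexx.
pose f (h : R) x := monomial s x * weight (t + h *: v) x.
pose df (h : R) x := \sum_i v ord0 i * (monomial (i :: s) x * weight (t + h *: v) x).
have fd (h : R) x : is_derive h 1 (f ^~ x) (df h x).
  have d1 : is_derive h 1 (fun h => dotr t (T x) + h * dotr v (T x)) (dotr v (T x)).
    have H : is_derive h 1 (cst (dotr t (T x)) + (dotr v (T x) \*: id)) (0 + dotr v (T x) *: 1).
      by apply: is_deriveD; apply: is_deriveZ.
    rewrite (_ : (fun _ => _) = cst (dotr t (T x)) + (dotr v (T x) \*: id)); last first.
      by apply/funext => z; rewrite -[RHS]/(_ + _ * _) [in RHS]mulrC.
    by apply: is_derive_eq H _; rewrite add0r -[LHS]/(_ * 1) mulr1.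
  have d2 := @is_derive1_comp R expR _ h _ _ (is_derive_expR (dotr t (T x) + h * dotr v (T x))) d1.
  have := @is_deriveZ _ _ _ _ (monomial s x * ef_carrier x) h 1 _ d2.
  rewrite (_ : _ \*: _ = f ^~ x); last first.
    apply/funext => z; rewrite -[LHS]/(_ * expR _) /f /weight dotrDl dotrZl.
    by rewrite mulrA.
  move=> H; apply: is_derive_eq H _.
  rewrite /df -[LHS]/(_ * _) /weight dotrDl dotrZl.
  have -> : dotr v (T x) = \sum_i v ord0 i * T x ord0 i by [].
  rewrite !mulr_sumr; apply: eq_bigr => i _.
  by rewrite /monomial big_cons; set E := expR _; ring.
have intf (h : R) : `|h| < r' -> mu.-integrable setT (EFin \o f h).
  by move=> /r'v[Th _]; exact: integrable_monomial.
have [G [G0 iG GB]] : exists G : ef_space M -> R, [/\ forall x, 0 <= G x,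
    mu.-integrable setT (EFin \o G) & forall h x, `|h| < r' -> `|df h x| <= G x].
  have /choice[G GP] i := dom (i :: s).
  exists (fun x => \sum_i `|v ord0 i| * G i x); split.
  - by move=> x; apply: sumr_ge0 => i _; rewrite mulr_ge0//; case: (GP i).
  - rewrite /comp; under eq_fun do rewrite -sumEFin.
    apply: integrable_sum => // i _; under eq_fun do rewrite EFinM.
    by apply: integrableZl => //; case: (GP i).
  - move=> h x /r'v[_ hr]; apply: le_trans (ler_norm_sum _ _ _) _.
    apply: ler_sum => i _; rewrite normrM ler_wpM2l//.
    by case: (GP i) => _ _; apply.
have I0 : (`]-r', r'[%classic : set R) 0 by rewrite /= in_itv /= oppr_lt0 r'0.
have inI (h : R) : (`]-r', r'[%classic : set R) h -> `|h| < r'.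
  by rewrite /= in_itv /= ltr_norml.
have d1f h x : partial1of2 f h x = df h x by rewrite partial1of2E; have [_ ->] := fd h x.
have B1 h x : (`]-r', r'[%classic : set R) h -> setT x -> derivable (f ^~ x) h 1.
  by move=> _ _; have [] := fd h x.
have B2 h x : (`]-r', r'[%classic : set R) h -> setT x -> `|partial1of2 f h x| <= G x.
  by move=> /inI hr _; rewrite d1f; exact: GB.
have B0 h (hI : (`]-r', r'[%classic : set R) h) := intf h (inI h hI).
have der := @derivable_under_integral R _ _ mu f setT measurableT 0 (-r') r' I0 B0 B1 G G0 iG B2.
have val := @differentiation_under_integral R _ _ mu f setT measurableT 0 (-r') r' I0 B0 B1 G G0 iG B2.
apply: line_is_derive.
have -> : (fun h : R => moment s (t + h *: v)) = (fun h => \int[mu]_(x in setT) f h x) by [].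
split => //; rewrite -derive1E val.
transitivity (\int[mu]_(x in setT) df 0 x).
  by apply: eq_Rintegral => x _; exact: d1f.
rewrite /Rintegral /df.
under eq_integral do rewrite -sumEFin.
rewrite integral_sum//; last first.
  move=> i; under eq_fun do rewrite EFinM; apply: integrableZl => //.
  by rewrite scale0r addr0; exact: integrable_monomial.
rewrite -sum_fine => [|i _]; last first.
  apply: integrable_fin_num => //; under eq_fun do rewrite EFinM; apply: integrableZl => //.
  by rewrite scale0r addr0; exact: integrable_monomial.
apply: eq_bigr => i _; rewrite scale0r addr0.
under eq_integral do rewrite EFinM.
rewrite integralZl//; last exact: integrable_monomial.
rewrite fineM//; apply: integrable_fin_num => //; exact: integrable_monomial.
Qed.

Lemma smooth_moment s n : smooth Theta n (moment s).
Proof.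
by elim: n s => //= n IH s; eexists; [exact: has_grad_moment|move=> i; exact: IH].
Qed.

End Dominated.
End Moments.

(** * Cumulants and expectations in an exponential family *)

Section GradientUniq.
Variables (R : realType) (p : nat) (D : set 'rV[R]_p).

(** The tool for differentiating an identity valid on an open set: gradients computed on the two
    sides must agree. *)
Lemma has_grad_uniq (f1 f2 : 'rV[R]_p -> R) g1 g2 i t : open D -> {in D, f1 =1 f2} ->
  has_grad D f1 g1 -> has_grad D f2 g2 -> D t -> g1 i t = g2 i t.
Proof.
move=> oD f12 d1 d2 Dt.
rewrite -(has_grad_partial i d2 Dt).
by rewrite -(has_grad_partial i (has_grad_ext oD f12 d1) Dt).
Qed.

Lemma has_grad_dotr (w : 'rV[R]_p) : has_grad D (fun t => dotr t w) (fun i _ => w ord0 i).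
Proof.
move=> t Dt v; apply: line_is_derive.
have H : is_derive (0 : R) 1 (cst (dotr t w) + (dotr v w \*: id)) (0 + dotr v w *: 1).
  by apply: is_deriveD; apply: is_deriveZ.
rewrite (_ : (fun _ => _) = cst (dotr t w) + (dotr v w \*: id)); last first.
  by apply/funext => z; rewrite dotrDl dotrZl -[RHS]/(_ + _ * _) [in RHS]mulrC.
by apply: is_derive_eq H _; rewrite add0r -[LHS]/(_ * 1) mulr1.
Qed.

Lemma has_grad_cst (a : R) : has_grad D (fun _ => a) (fun _ _ => 0).
Proof.
move=> t Dt v; apply: is_derive_eq (is_derive_cst _ _ _) _.
by rewrite big1// => i _; rewrite mulr0.
Qed.

End GradientUniq.

Section Expectation.
Variables (R : realType) (p : nat) (M : exp_family R p).
Local Notation mu := (ef_base M).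
Local Notation T := (@ef_stat R p M).
Local Notation K := (@log_partition R p M).
Local Notation Z := (@moment R p M [::]).
Implicit Types (t v : 'rV[R]_p) (x : ef_space M) (s : seq 'I_p) (g h : ef_space M -> R).

Lemma moment_nil t : Z t = fine (partition_fun M t).
Proof.
congr fine; apply: eq_integral => x _.
by rewrite /monomial big_nil mul1r.
Qed.

Lemma moment_nil_gt0 t : natural_space M t -> 0 < Z t.
Proof. by rewrite moment_nil => /= /fine_gt0. Qed.

Lemma log_partitionE t : K t = ln (Z t).
Proof. by rewrite moment_nil. Qed.

Lemma densityE t x : natural_space M t -> density t x = weight t x / Z t.
Proof.
move=> nt; rewrite /density log_partitionE expRD expRN lnK ?posrE ?moment_nil_gt0//.
by rewrite mulrA.
Qed.

Lemma density_ge0 t x : 0 <= density t x.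
Proof. by rewrite mulr_ge0 ?ef_carrier_ge0 ?expR_ge0. Qed.

Lemma density_gt0 t x : (0 < density t x) = (0 < ef_carrier x).
Proof. by rewrite /density pmulr_lgt0 ?expR_gt0. Qed.

Lemma density_eq0 t x : ~~ (0 < density t x) -> density t x = 0.
Proof. by rewrite -leNgt => d0; apply/eqP; rewrite eq_le d0 density_ge0. Qed.

Lemma measurable_density t : measurable_fun setT (fun x => density t x).
Proof.
apply: measurable_funM; first exact: ef_carrier_measurable.
apply: measurableT_comp => //; apply: measurable_funB => //; exact: measurable_dotr.
Qed.

Lemma eq_integrable_under t g h : g =1 h -> integrable_under t g -> integrable_under t h.
Proof. by move=> /funext ->. Qed.

Lemma integrable_underD t g h : integrable_under t g -> integrable_under t h ->
  integrable_under t (fun x => g x + h x).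
Proof.
move=> ig ih; rewrite /integrable_under; under eq_fun do rewrite mulrDl EFinD.
exact: integrableD.
Qed.

Lemma integrable_underZ t (a : R) g : integrable_under t g ->
  integrable_under t (fun x => a * g x).
Proof.
move=> ig; rewrite /integrable_under; under eq_fun do rewrite -mulrA EFinM.
exact: integrableZl.
Qed.

Lemma integrable_under_sum t n (g : 'I_n -> ef_space M -> R) :
  (forall i, integrable_under t (g i)) ->
  integrable_under t (fun x => \sum_i g i x).
Proof.
move=> ig; rewrite /integrable_under; under eq_fun do rewrite mulr_suml -sumEFin.
by apply: integrable_sum => // i _; exact: ig.
Qed.

(** The bound is asked only where the density is positive, because the likelihood equations fail to
    make sense where it vanishes. *)
Lemma le_integrable_under t g h : measurable_fun setT g ->
  (forall x, 0 < density t x -> `|g x| <= h x) ->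
  integrable_under t h -> integrable_under t g.
Proof.
move=> mg gh ih; apply: le_integrable ih => //.
  by apply/measurable_EFinP; apply: measurable_funM => //; exact: measurable_density.
move=> x _; rewrite !abse_EFin lee_fin [leLHS]normrM [leRHS]normrM.
have [/gh gx|/density_eq0 ->] := boolP (0 < density t x); last by rewrite normr0 !mulr0.
by rewrite ler_wpM2r// (le_trans gx)// ler_norm.
Qed.

Lemma expectD t g h : integrable_under t g -> integrable_under t h ->
  expect t (fun x => g x + h x) = expect t g + expect t h.
Proof.
move=> ig ih; rewrite /expect -RintegralD//.
by apply: eq_Rintegral => x _; rewrite mulrDl.
Qed.

Lemma expectZ t (a : R) g : integrable_under t g ->
  expect t (fun x => a * g x) = a * expect t g.
Proof.
move=> ig; rewrite /expect -RintegralZl//.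
by apply: eq_Rintegral => x _; rewrite mulrA.
Qed.

Lemma expect_sum t n (g : 'I_n -> ef_space M -> R) :
  (forall i, integrable_under t (g i)) ->
  expect t (fun x => \sum_i g i x) = \sum_i expect t (g i).
Proof.
elim: n g => [|n IH] g ig.
  rewrite big_ord0 /expect (@eq_Rintegral _ _ _ _ _ (cst 0)) => [|x _].
    by rewrite Rintegral_cst// mul0r.
  by rewrite big_ord0 mul0r.
rewrite big_ord_recl -IH// -expectD//; last exact: integrable_under_sum.
by rewrite /expect; apply: eq_Rintegral => x _; rewrite big_ord_recl.
Qed.

Lemma ler_expect t g h : integrable_under t g -> integrable_under t h ->
  (forall x, 0 < density t x -> g x <= h x) -> expect t g <= expect t h.
Proof.
move=> ig ih gh; apply: le_Rintegral => // x _.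
have [/gh gx|/density_eq0 ->] := boolP (0 < density t x); last by rewrite !mulr0.
by rewrite ler_wpM2r// density_ge0.
Qed.

Lemma ler_norm_expect t g h : integrable_under t g -> integrable_under t h ->
  (forall x, 0 < density t x -> `|g x| <= h x) -> `|expect t g| <= expect t h.
Proof.
move=> ig ih gh; rewrite ler_norml; apply/andP; split.
  rewrite -mulN1r -expectZ//; apply: ler_expect => //; first exact: integrable_underZ.
  by move=> x /gh; rewrite ler_norml mulN1r => /andP[].
by apply: ler_expect => // x /gh /(le_trans (ler_norm _)).
Qed.

Section Cumulants.
Variable Theta : set 'rV[R]_p.
Hypotheses (Theta_open : open Theta) (Theta_nat : Theta `<=` natural_space M).

Lemma integrable_under_monomial t s : Theta t -> integrable_under t (@monomial R p M s).
Proof.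
move=> Tt; rewrite /integrable_under.
under eq_fun do rewrite (densityE _ (Theta_nat Tt)) mulrA mulrC EFinM.
apply: integrableZl => //; exact: integrable_monomial Tt.
Qed.

Lemma expect_monomial t s : Theta t -> expect t (@monomial R p M s) = moment M s t / Z t.
Proof.
move=> Tt; rewrite /expect /moment -RintegralZr//; last exact: integrable_monomial Tt.
by apply: eq_Rintegral => x _; rewrite (densityE _ (Theta_nat Tt)) mulrA.
Qed.

Lemma integrable_under_cst t (a : R) : Theta t -> integrable_under t (fun _ : ef_space M => a).
Proof.
move=> Tt; apply: eq_integrable_under (integrable_underZ a (integrable_under_monomial [::] Tt)).
by move=> x; rewrite /monomial big_nil mulr1.
Qed.

Lemma expect_cst t (a : R) : Theta t -> expect t (fun _ : ef_space M => a) = a.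
Proof.
move=> Tt; have := expectZ a (integrable_under_monomial [::] Tt).
rewrite expect_monomial// divff ?gt_eqF ?moment_nil_gt0 ?mulr1//; last exact: Theta_nat.
by move=> E; rewrite -[RHS]E; apply: eq_Rintegral => x _; rewrite /monomial big_nil mulr1.
Qed.

(** Exponential tilting: multiplying the density at [t] by this exponential gives, up to the factor
    on the right, the density at [t'], which has total mass 1. *)
Lemma expect_expR t t' : Theta t -> Theta t' ->
  integrable_under t (fun x => expR (dotr (t' - t) (T x))) /\
  expect t (fun x => expR (dotr (t' - t) (T x))) = expR (K t' - K t).
Proof.
move=> Tt Tt'.
have E x : expR (dotr (t' - t) (T x)) * density t x = expR (K t' - K t) * density t' x.
  rewrite /density; have -> : dotr t' (T x) = dotr (t' - t) (T x) + dotr t (T x).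
    by rewrite -dotrDl subrK.
  move: (dotr (t' - t) (T x)) (dotr t (T x)) (K t') (K t) (ef_carrier x) => d e k' k c.
  rewrite mulrCA [RHS]mulrCA -!expRD; congr (_ * expR _); ring.
have I := integrable_underZ (expR (K t' - K t)) (integrable_under_cst 1 Tt').
split.
  rewrite /integrable_under (_ : (fun x => _) =
    (fun x => (expR (K t' - K t) * 1 * density t' x)%:E)); first exact: I.
  by apply/funext => x; rewrite E mulr1.
transitivity (expect t' (fun _ : ef_space M => expR (K t' - K t) * 1)).
  by apply: eq_Rintegral => x _; rewrite E mulr1.
by rewrite expect_cst// mulr1.
Qed.

Lemma smooth_log_partition n : smooth Theta n K.
Proof.
have : smooth Theta n (fun t => ln (Z t)).
  apply: smooth_ln => [t /Theta_nat/moment_nil_gt0//|]; exact: smooth_moment.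
by apply: smooth_ext => // t _; rewrite log_partitionE.
Qed.

Lemma has_grad_partials s : has_grad Theta (partials s K) (fun i => partials (i :: s) K).
Proof.
apply: (@smooth_has_grad _ _ _ 0) => //.
by apply: smooth_partials => //; exact: smooth_log_partition.
Qed.

(* Differentiating K_i Z = Z_i repeatedly expresses the cumulants through the moments,
   which are visibly symmetric in their indices; this replaces Schwarz's theorem. *)
Lemma partials1_mul t i : Theta t -> partials [:: i] K t * Z t = moment M [:: i] t.
Proof.
move=> Tt; have Zt := moment_nil_gt0 (Theta_nat Tt).
have := @has_grad_comp _ _ _ _ _ (@ln R) (fun y : R => y^-1)
  (has_grad_moment Theta_open Theta_nat [::]) _.
move=> /(_ (fun t Tt => is_derive1_ln (moment_nil_gt0 (Theta_nat Tt)))) d.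
have H : {in Theta, (fun t => ln (Z t)) =1 K} by move=> u _; rewrite log_partitionE.
rewrite -(has_grad_uniq i Theta_open H d (has_grad_partials [::]) Tt) /=.
by rewrite mulrAC mulVf ?mul1r// gt_eqF.
Qed.

Lemma partials2_mul t j i : Theta t ->
  partials [:: i] K t * moment M [:: j] t + partials [:: j; i] K t * Z t =
  moment M [:: j; i] t.
Proof.
move=> Tt.
have H : {in Theta, (fun t => partials [:: i] K t * Z t) =1 moment M [:: i]}.
  by move=> u; rewrite inE => /partials1_mul.
have d1 := has_gradM (has_grad_partials [:: i]) (has_grad_moment Theta_open Theta_nat [::]).
exact: (has_grad_uniq j Theta_open H d1 (has_grad_moment Theta_open Theta_nat _) Tt).
Qed.

Lemma partials3_mul t l j i : Theta t ->
  partials [:: i] K t * moment M [:: l; j] t + partials [:: l; i] K t * moment M [:: j] t +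
  (partials [:: j; i] K t * moment M [:: l] t + partials [:: l; j; i] K t * Z t) =
  moment M [:: l; j; i] t.
Proof.
move=> Tt.
have H : {in Theta, (fun t => partials [:: i] K t * moment M [:: j] t +
    partials [:: j; i] K t * Z t) =1 moment M [:: j; i]}.
  by move=> u; rewrite inE => /partials2_mul.
have dm := has_grad_moment Theta_open Theta_nat.
have d1 := has_gradD (has_gradM (has_grad_partials [:: i]) (dm [:: j]))
  (has_gradM (has_grad_partials [:: j; i]) (dm [::])).
exact: (has_grad_uniq l Theta_open H d1 (dm _) Tt).
Qed.

Lemma moment_perm s s' t : perm_eq s s' -> moment M s t = moment M s' t.
Proof.
move=> ss'; apply: eq_Rintegral => x _; congr (_ * _).
by rewrite /monomial (perm_big _ ss').
Qed.

Lemma partials2C t i j : Theta t -> partials [:: i; j] K t = partials [:: j; i] K t.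
Proof.
move=> Tt; have Z0 : Z t != 0 by rewrite gt_eqF// moment_nil_gt0//; exact: Theta_nat.
apply: (mulIf Z0).
have E : moment M [:: i; j] t = moment M [:: j; i] t.
  by apply: moment_perm; exact: permEl (perm_catC [:: i] [:: j]).
have := partials2_mul i j Tt; have := partials2_mul j i Tt.
rewrite -(partials1_mul i Tt) -(partials1_mul j Tt) E => H2 H1.
move: (partials [:: i] K t) (partials [:: j] K t) (partials [:: i; j] K t)
  (partials [:: j; i] K t) (Z t) H1 H2 => a b c d z <- H.
by apply: (addrI (a * (b * z))); rewrite H mulrCA.
Qed.

(** In [partials3_mul], exchanging the two outermost indices swaps two of the lower-order terms and
    leaves the moments unchanged, so the last terms agree. *)
Lemma partials3C t i j k : Theta t ->
  partials [:: i; j; k] K t = partials [:: j; i; k] K t.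
Proof.
move=> Tt; have Z0 : Z t != 0 by rewrite gt_eqF// moment_nil_gt0//; exact: Theta_nat.
have ij : perm_eq [:: i; j] [:: j; i] by exact: permEl (perm_catC [:: i] [:: j]).
have ijk : perm_eq ([:: i; j] ++ [:: k]) ([:: j; i] ++ [:: k]) by rewrite perm_cat2r.
have H2 := partials3_mul i j k Tt; have H1 := partials3_mul j i k Tt.
rewrite (moment_perm t ij) (moment_perm t ijk) in H2.
have cancel (a b c d e m : R) : a + b + (c + d) = m -> a + c + (b + e) = m -> d = e.
  by move=> <-; rewrite -!addrA [c + (b + e)]addrCA => /addrI/addrI/addrI.
exact: (mulIf Z0 (cancel _ _ _ _ _ _ H2 H1)).
Qed.

(** Differentiate the symmetry of the second cumulants. Together with [partials3C] this generates
    all permutations of the indices. *)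
Lemma partials3_swap23 t i j k : Theta t ->
  partials [:: i; j; k] K t = partials [:: i; k; j] K t.
Proof.
move=> Tt; apply: (has_grad_uniq i Theta_open _ (has_grad_partials [:: j; k]) (has_grad_partials [:: k; j]) Tt).
by move=> u; rewrite inE => /partials2C.
Qed.

Definition centered t i x : R := T x ord0 i - partials [:: i] K t.

Lemma expect_stat t i : Theta t -> integrable_under t (fun x => T x ord0 i) /\
  expect t (fun x => T x ord0 i) = partials [:: i] K t.
Proof.
move=> Tt; have E : (fun x => T x ord0 i) = monomial [:: i].
  by apply/funext => x; rewrite /monomial big_seq1.
rewrite E expect_monomial// -partials1_mul// mulfK ?gt_eqF ?moment_nil_gt0//; last exact: Theta_nat.
by split => //; exact: integrable_under_monomial.
Qed.

Lemma expect_centered t i : Theta t ->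
  integrable_under t (centered t i) /\ expect t (centered t i) = 0.
Proof.
move=> Tt; have [I E] := expect_stat i Tt.
have C := integrable_under_cst (- partials [:: i] K t) Tt.
split; first exact: integrable_underD I C.
by rewrite (expectD I C) E expect_cst// subrr.
Qed.

Lemma expect_centered2 t i j : Theta t ->
  integrable_under t (fun x => centered t i x * centered t j x) /\
  expect t (fun x => centered t i x * centered t j x) = partials [:: i; j] K t.
Proof.
move=> Tt; have Z0 : Z t != 0 by rewrite gt_eqF// moment_nil_gt0//; exact: Theta_nat.
have [[Ii Ei] [Ij Ej]] := (expect_stat i Tt, expect_stat j Tt).
have Iij := integrable_under_monomial [:: i; j] Tt.
pose a := partials [:: i] K t; pose b := partials [:: j] K t.
have I1 := integrable_underZ (- b) Ii; have I2 := integrable_underZ (- a) Ij.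
have C := integrable_under_cst (a * b) Tt.
have -> : (fun x => centered t i x * centered t j x) =
   (fun x => monomial [:: i; j] x + ((- b) * T x ord0 i + ((- a) * T x ord0 j + a * b))).
  apply/funext => x; rewrite /centered /monomial big_cons big_seq1 -/a -/b; ring.
have J2 := integrable_underD I2 C; have J1 := integrable_underD I1 J2.
split; first exact: integrable_underD.
rewrite (expectD Iij J1) (expectD I1 J2) (expectD I2 C) (expectZ _ Ii) (expectZ _ Ij) expect_cst// Ei Ej.
rewrite expect_monomial// -(partials2_mul i j Tt) -(partials1_mul i Tt).
have alg (u w c z : R) : z != 0 ->
  (w * (u * z) + c * z) / z + (- w * u + (- u * w + u * w)) = c by move=> z0; field.
exact: alg.
Qed.

Lemma has_grad_log_density x : has_grad Theta
  (fun t => ln (ef_carrier x) + (dotr t (T x) - K t)) (fun i t => centered t i x).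
Proof.
move=> t Tt v; have := has_gradD (has_grad_cst (D := Theta) (ln (ef_carrier x)))
  (has_gradD (has_grad_dotr (D := Theta) (T x)) (has_gradN (has_grad_partials [::]))).
move=> /(_ t Tt v) H; apply: is_derive_eq H _; apply: eq_bigr => i _.
by rewrite add0r.
Qed.

Lemma ln_density t x : 0 < ef_carrier x ->
  ln (density t x) = ln (ef_carrier x) + (dotr t (T x) - K t).
Proof. by move=> c0; rewrite /density lnM ?posrE ?expR_gt0// expRK. Qed.

(** Where the carrier vanishes, the logarithm is a default value unrelated to the statistic; such
    points contribute nothing to expectations. *)
Lemma scoreE t x i : Theta t -> 0 < ef_carrier x -> score t x i = centered t i x.
Proof.
move=> Tt c0; rewrite /score (_ : (fun _ => _) = (fun t => ln (ef_carrier x) + (dotr t (T x) - K t))).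
  by rewrite (has_grad_partial _ (has_grad_log_density x) Tt).
by apply/funext => u; rewrite ln_density.
Qed.

Lemma fisher_infoE t i j : Theta t -> fisher_info M t i j = partials [:: i; j] K t.
Proof.
move=> Tt; rewrite mxE -(expect_centered2 i j Tt).2; apply: eq_Rintegral => x _.
have [|/density_eq0 ->] := boolP (0 < density t x); last by rewrite !mulr0.
by rewrite density_gt0 => c0; rewrite !scoreE.
Qed.

End Cumulants.
End Expectation.

(** * Deterministic expansion of a root of the penalized score *)

Ltac nonneg := repeat match goal with
  | |- is_true (@Order.le _ _ _ (GRing.add _ _)) => apply: addr_ge0
  | |- is_true (@Order.le _ _ _ (GRing.mul _ _)) => apply: mulr_ge0
  | |- is_true (@Order.le _ _ _ (GRing.exp _ _)) => apply: exprn_ge0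
  | |- is_true (@Order.le _ _ _ (GRing.inv _)) => rewrite invr_ge0
  | |- _ => done
  | |- _ => apply: ltW; done
  end.

Section Expansion.
Variables (R : realType) (p : nat).
Local Notation V := 'rV[R]_p.
Variables (K1 : 'I_p -> V -> R) (K2 : 'I_p -> 'I_p -> V -> R)
  (K3 : 'I_p -> 'I_p -> 'I_p -> V -> R) (K4 : 'I_p -> 'I_p -> 'I_p -> 'I_p -> V -> R).
Variables (theta : V) (rho c C N : R).

Let near_theta : set V := [set t | `|t - theta| < rho].

Hypotheses (c0 : 0 < c) (C0 : 0 <= C) (N0 : 0 < N) (rho1 : rho <= 1).
Hypothesis rho_small : p%:R ^+ 3 * C * rho <= c / 2.
Hypothesis dK1 : forall l, has_grad near_theta (K1 l) (fun i => K2 i l).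
Hypothesis dK2 : forall i l, has_grad near_theta (K2 i l) (fun j => K3 j i l).
Hypothesis dK3 : forall j i l, has_grad near_theta (K3 j i l) (fun m => K4 m j i l).
Hypothesis K3sym : forall l j i t, near_theta t -> K3 j i l t = K3 l j i t.
Hypothesis K3_le : forall l j i t, near_theta t -> `|K3 l j i t| <= C * N.
Hypothesis K4_le : forall m l j i t, near_theta t -> `|K4 m l j i t| <= C * N.

Definition info (t : V) : 'M[R]_p := \matrix_(i, j) K2 i j t.

Lemma infoE t i j : info t i j = K2 i j t. Proof. by rewrite mxE. Qed.

Hypothesis info_coercive : coercive (c * N) (info theta).

(* By Jacobi's formula, the l-th partial derivative of [ln (\det (info t))]. *)
Definition grad_logdet (l : 'I_p) (t : V) : R :=
  \sum_i \sum_j invmx (info t) i j * K3 l j i t.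

Definition third_form (X : 'M[R]_p) : V :=
  \row_l \sum_i \sum_j X i j * K3 l j i theta.

Let A := info theta.
Let lam : R := p%:R / c.

Let cN0 : 0 < c * N. Proof. exact: mulr_gt0. Qed.
Let N1 : 0 <= N. Proof. exact: ltW. Qed.
Let CN0 : 0 <= C * N. Proof. exact: mulr_ge0. Qed.
Let lam0 : 0 <= lam. Proof. by rewrite divr_ge0// ltW. Qed.
Let lamN : p%:R / (c * N) = lam / N.
Proof. by rewrite /lam invfM mulrA. Qed.

Let near_segment t (s : R) : near_theta t -> 0 <= s <= 1 ->
  near_theta (theta + s *: (t - theta)).
Proof.
rewrite /near_theta /= => tn /andP[s0 s1]; rewrite addrAC subrr add0r normrZ ger0_norm//.
by apply: le_lt_trans tn; rewrite ler_piMl.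
Qed.

Let near_self t : near_theta t -> near_theta theta.
Proof. by rewrite /near_theta /= subrr normr0; exact: le_lt_trans. Qed.

Lemma info_lipschitz t : near_theta t -> `|A - info t| <= p%:R * `|t - theta| * (C * N).
Proof.
move=> tn; apply: mx_norm_le => [|i j]; first by nonneg.
rewrite !mxE distrC -[t in K2 i j t](subrKC theta).
apply: (@grad_lipschitz _ _ near_theta _ _ _ _ (fun l => K3 l i j)) => //.
  by move=> s; exact: near_segment.
by move=> l x; exact: K3_le.
Qed.

(** The hypothesis [rho_small] is made for this: the Lipschitz bound on the information, times the
    [p ^ 2] of [coercive_perturb], stays below half of c N. *)
Lemma info_near_coercive t : near_theta t -> coercive (c * N / 2) (info t).
Proof.
move=> tn; apply: coercive_perturb info_coercive _.
have H : `|A - info t| <= p%:R * rho * (C * N).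
  apply: le_trans (info_lipschitz tn) _.
  by rewrite ler_wpM2r// ler_wpM2l// ltW.
apply: le_trans (ler_wpM2l _ H) _; first by rewrite exprn_ge0.
have -> : p%:R ^+ 2 * (p%:R * rho * (C * N)) = p%:R ^+ 3 * C * rho * N :> R by ring.
have -> : c * N / 2 = c / 2 * N by ring.
by rewrite ler_wpM2r// ltW.
Qed.

Let Cg : R := p%:R ^+ 2 * (p%:R ^+ 3 * (2 * lam ^+ 2) * C ^+ 2 + lam * p%:R * C).

Let Cg0 : 0 <= Cg.
Proof. by rewrite /Cg; nonneg. Qed.

(** The inverse information is of order 1/N and the third and fourth cumulants of order N, so the
    constant is free of N. The product rule separates the variation of the inverse from that of the
    third cumulants. *)
Lemma grad_logdet_lipschitz l t : near_theta t ->
  `|grad_logdet l t - grad_logdet l theta| <= Cg * `|t - theta|.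
Proof.
move=> tn; have thn := near_self tn.
set B := info t; set d := `|t - theta|.
have cB := info_near_coercive tn; have cN2 : 0 < c * N / 2 by rewrite divr_gt0.
have nB : `|invmx B| <= 2 * lam / N.
  apply: le_trans (coercive_invmx cN2 cB) _.
  by rewrite invf_div mulrCA mulrA -mulrA lamN mulrA.
have nA : `|invmx A| <= lam / N by rewrite -lamN; exact: coercive_invmx.
have dBA : `|invmx B - invmx A| <= p%:R ^+ 3 * (2 * lam ^+ 2) * C * d / N.
  rewrite (invmxB (coercive_unit cN0 info_coercive) (coercive_unit cN2 cB)).
  apply: le_trans (ler_norm_mulmx _ _) _.
  have H1 : `|invmx B *m (A - B)| <= p%:R * (2 * lam / N * (p%:R * d * (C * N))).
    apply: le_trans (ler_norm_mulmx _ _) _.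
    by rewrite ler_wpM2l// ler_pM// info_lipschitz.
  apply: le_trans (ler_wpM2l _ (ler_pM _ _ H1 nA)) _ => //.
  by rewrite le_eqVlt; apply/orP; left; apply/eqP; field; rewrite gt_eqF.
rewrite /grad_logdet -sumrB.
rewrite [leRHS](_ : _ = p%:R * (p%:R * ((p%:R ^+ 3 * (2 * lam ^+ 2) * C * d / N) * (C * N)
   + lam / N * (p%:R * d * (C * N))))); last by rewrite /Cg; field; rewrite gt_eqF.
apply: ler_norm_sum_const => i; rewrite -sumrB; apply: ler_norm_sum_const => j.
have -> : invmx B i j * K3 l j i t - invmx A i j * K3 l j i theta =
  (invmx B - invmx A) i j * K3 l j i t + invmx A i j * (K3 l j i t - K3 l j i theta).
  by rewrite !mxE; ring.
apply: le_trans (ler_normD _ _) _; rewrite !normrM; apply: lerD; apply: ler_pM => //.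
- exact: le_trans (ler_norm_coord _ _ _) dBA.
- exact: K3_le.
- exact: le_trans (ler_norm_coord _ _ _) nA.
rewrite -[t in K3 _ _ _ t](subrKC theta).
apply: (@grad_lipschitz _ _ near_theta _ _ _ _ (fun m => K4 m l j i)) => //.
  by move=> s; exact: near_segment.
by move=> m x; exact: K4_le.
Qed.

Lemma third_formB X Y : third_form X - third_form Y = third_form (X - Y).
Proof.
apply/rowP => l; rewrite !mxE -sumrB; apply: eq_bigr => i _.
by rewrite -sumrB; apply: eq_bigr => j _; rewrite !mxE mulrBl.
Qed.

Lemma third_form_le X : near_theta theta -> `|third_form X| <= p%:R ^+ 2 * C * N * `|X|.
Proof.
move=> thn; apply: mx_norm_le => [|i l]; first by nonneg.
rewrite mxE (_ : p%:R ^+ 2 * C * N * `|X| = p%:R * (p%:R * (`|X| * (C * N)))); last by ring.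
apply: ler_norm_sum_const => a; apply: ler_norm_sum_const => b.
by rewrite normrM ler_pM ?ler_norm_coord// K3_le.
Qed.

Lemma rank_one_norm (u v : V) : `|u^T *m v| <= `|u| * `|v|.
Proof.
apply: mx_norm_le => [|i j]; first by rewrite mulr_ge0.
by rewrite mxE big_ord1 mxE normrM ler_pM// ler_norm_coord.
Qed.

Lemma rank_oneB (u v : V) :
  `|u^T *m u - v^T *m v| <= `|u - v| * (`|u| + `|v|).
Proof.
have -> : u^T *m u - v^T *m v = (u - v)^T *m u + v^T *m (u - v).
  by rewrite [(u - v)^T]linearB mulmxBl mulmxBr addrA subrK.
apply: le_trans (ler_normD _ _) _; rewrite mulrDr; apply: lerD.
  exact: rank_one_norm.
by apply: le_trans (rank_one_norm _ _) _; rewrite mulrC.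
Qed.

(* The V of the introduction, as a function of u. *)
Definition second_order_term (u : V) : V :=
  u - 2^-1 *: (third_form (u^T *m u - invmx A) *m invmx A).

(** The summands dominate, in turn, the third-cumulant term, the cubic Taylor remainder and the
    variation of the penalty. *)
Definition expansion_const : R :=
  lam * p%:R ^+ 2 * C * (1 + lam) + lam * p%:R ^+ 3 * C + lam * Cg.

Section Root.
Variables (t S : V).
Hypothesis tn : near_theta t.
Hypothesis estimating_eq : forall l,
  S ord0 l = K1 l t - K1 l theta - 2^-1 * grad_logdet l t.

Let delta := t - theta.
Let u := S *m invmx A.
Let rem : V := S - delta *m A - 2^-1 *: third_form (delta^T *m delta - invmx A).

Let thn := near_self tn.

(** The cubic term is the Taylor remainder of [K1]; the linear one is the cost of evaluating the
    penalty at [theta] instead of [t]. *)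
Lemma remainder_le : `|rem| <= p%:R ^+ 3 * C * N * `|delta| ^+ 3 + Cg * `|delta|.
Proof.
apply: mx_norm_le => [|a l].
  by nonneg.
have := @grad_taylor3 _ _ near_theta theta delta _ (K1 l) (fun i => K2 i l)
   (fun i j => K3 j i l) (fun i j m => K4 m j i l) (C * N) (dK1 l) _ _ _.
move=> /(_ (fun s => near_segment tn) (fun i => dK2 i l) (fun i j => dK3 j i l)).
move=> /(_ (fun i j m x => @K4_le m j i l x)).
have -> : theta + delta = t by rewrite /delta subrKC.
rewrite (_ : (p%:R * `|delta|) ^+ 3 * (C * N) = p%:R ^+ 3 * C * N * `|delta| ^+ 3); last by ring.
move=> taylor; have lip := grad_logdet_lipschitz l tn.
rewrite (ord1 a).
have -> : rem ord0 l = (K1 l t - K1 l theta - \sum_i delta ord0 i * K2 i l theta -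
   2^-1 * \sum_i delta ord0 i * \sum_j delta ord0 j * K3 j i l theta) -
   2^-1 * (grad_logdet l t - grad_logdet l theta).
  rewrite /rem -third_formB !mxE estimating_eq.
  have -> : \sum_j delta ord0 j * A j l = \sum_i delta ord0 i * K2 i l theta.
    by apply: eq_bigr => i _; rewrite [A i l]mxE.
  have -> : \sum_i \sum_j (delta^T *m delta) i j * K3 l j i theta =
     \sum_i delta ord0 i * \sum_j delta ord0 j * K3 j i l theta.
    apply: eq_bigr => i _; rewrite mulr_sumr; apply: eq_bigr => j _.
    by rewrite mxE big_ord1 mxE (K3sym l j i thn) mulrA.
  (* By definition [third_form (invmx A)] is the penalty gradient at [theta]; this merges the
     penalty with the quadratic Taylor term. *)
  rewrite -/(grad_logdet l theta).
  set x1 := \sum_i _; set x2 := \sum_i _; ring.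
apply: le_trans (ler_normB _ _) _; apply: lerD => //.
rewrite normrM; apply: le_trans lip.
by rewrite ler_piMl// ger0_norm ?invr_ge0// invf_le1// ler1n.
Qed.

Let uE : u = delta + 2^-1 *: (third_form (delta^T *m delta - invmx A) *m invmx A) + rem *m invmx A.
Proof.
rewrite /u scalemxAl -{1}[delta](mulmxK (coercive_unit cN0 info_coercive)).
rewrite -mulmxDl -mulmxDl; congr (_ *m _).
by rewrite /rem -(addrA S) -opprD [RHS]addrC subrK.
Qed.

Let invA_row (v : V) : `|v *m invmx A| <= lam / N * `|v|.
Proof. by rewrite -lamN; exact: coercive_invmx_row. Qed.

Let halfZ_le (v : V) : `|2^-1 *: v| <= `|v|.
Proof. by rewrite normrZ ler_piMl// ger0_norm ?invr_ge0// invf_le1// ler1n. Qed.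

Let d1 : `|delta| <= 1. Proof. exact/ltW/(lt_le_trans tn). Qed.

(** Since |delta| <= 1, the cubic remainder is absorbed by the square and |delta| / N by 1 / N. *)
Lemma first_order_le : `|delta - u| <= expansion_const * (`|delta| ^+ 2 + N^-1).
Proof.
rewrite distrC (_ : u - delta = 2^-1 *: (third_form (delta^T *m delta - invmx A) *m invmx A) +
  rem *m invmx A); last first.
  have cancel (a b d : V) : a + b + d - a = b + d by rewrite -addrA addrC addrA subrK addrC.
  by rewrite [in LHS]uE; exact: cancel.
have dle1 := d1; set d := `|delta| in dle1 *; have d0 : 0 <= d by exact: normr_ge0.
have H1 : `|2^-1 *: (third_form (delta^T *m delta - invmx A) *m invmx A)| <=
   lam / N * (p%:R ^+ 2 * C * N * (d ^+ 2 + lam / N)).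
  apply: le_trans (halfZ_le _) _; apply: le_trans (invA_row _) _.
  apply: ler_wpM2l; first by nonneg.
  apply: le_trans (third_form_le _ thn) _; apply: ler_wpM2l; first by nonneg.
  apply: le_trans (ler_normB _ _) _; rewrite lerD//.
    by rewrite expr2; exact: rank_one_norm.
  by rewrite -lamN; exact: coercive_invmx.
have H2 : `|rem *m invmx A| <= lam / N * (p%:R ^+ 3 * C * N * d ^+ 3 + Cg * d).
  apply: le_trans (invA_row _) _; apply: ler_wpM2l; [by nonneg|exact: remainder_le].
apply: le_trans (ler_normD _ _) _; apply: le_trans (lerD H1 H2) _.
have iN : 0 <= N^-1 by rewrite invr_ge0 ltW.
have d2 : 0 <= d ^+ 2 by rewrite exprn_ge0.
have d3 : d ^+ 3 <= d ^+ 2 by rewrite exprSr ler_piMr.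
have -> : lam / N * (p%:R ^+ 2 * C * N * (d ^+ 2 + lam / N)) =
   lam * p%:R ^+ 2 * C * (d ^+ 2 + lam * N^-1) by field; rewrite gt_eqF.
have -> : lam / N * (p%:R ^+ 3 * C * N * d ^+ 3 + Cg * d) =
   lam * p%:R ^+ 3 * C * d ^+ 3 + lam * Cg * (d * N^-1) by field; rewrite gt_eqF.
rewrite /expansion_const 2!mulrDl addrA.
have a0 : 0 <= lam * p%:R ^+ 2 * C by nonneg.
have b0 : 0 <= lam * p%:R ^+ 3 * C by nonneg.
have e0 : 0 <= lam * Cg by rewrite mulr_ge0.
have l0 := lam0.
apply: lerD; last by rewrite ler_wpM2l// ler_wpDl// ler_piMl.
apply: lerD; last by rewrite ler_wpM2l// ler_wpDr.
rewrite -[leRHS]mulrA ler_wpM2l// mulrDl mul1r mulrDr.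
move: (N^-1) (d ^+ 2) iN d2 lam0 => n dd iN d2 l1.
have := mulr_ge0 l1 d2; lra.
Qed.

(** Now the quadratic term is kept and only its argument changes from delta to [u], which costs
    |delta - u| (|delta| + |u|). *)
Lemma second_order_le : `|delta - second_order_term u| <=
  expansion_const * (`|delta - u| * (`|delta| + `|u|) + `|delta| ^+ 3 + `|delta| / N).
Proof.
have -> : delta - second_order_term u =
  - (2^-1 *: (third_form (delta^T *m delta - u^T *m u) *m invmx A) + rem *m invmx A).
  rewrite /second_order_term.
  have -> : delta^T *m delta - u^T *m u = (delta^T *m delta - invmx A) - (u^T *m u - invmx A).
    by rewrite opprB [in RHS]addrA subrK.
  rewrite -(third_formB (delta^T *m delta - invmx A) (u^T *m u - invmx A)) mulmxBl scalerBr.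
  have cancel (a b d y : V) : a - (a + b + d - y) = - (b - y + d).
    by apply/rowP => i; rewrite !mxE; ring.
  rewrite [X in delta - (X - _)]uE; exact: cancel.
rewrite normrN.
have dle1 := d1; set d := `|delta| in dle1 *; have d0 : 0 <= d by exact: normr_ge0.
set D := `|delta - u|; set w := `|u|.
have D0 : 0 <= D by exact: normr_ge0.
have w0 : 0 <= w by exact: normr_ge0.
have H1 : `|2^-1 *: (third_form (delta^T *m delta - u^T *m u) *m invmx A)| <=
   lam / N * (p%:R ^+ 2 * C * N * (D * (d + w))).
  apply: le_trans (halfZ_le _) _; apply: le_trans (invA_row _) _.
  apply: ler_wpM2l; first by nonneg.
  apply: le_trans (third_form_le _ thn) _; apply: ler_wpM2l; first by nonneg.
  exact: rank_oneB.
have H2 : `|rem *m invmx A| <= lam / N * (p%:R ^+ 3 * C * N * d ^+ 3 + Cg * d).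
  apply: le_trans (invA_row _) _; apply: ler_wpM2l; [by nonneg|exact: remainder_le].
apply: le_trans (ler_normD _ _) _; apply: le_trans (lerD H1 H2) _.
have iN : 0 <= N^-1 by rewrite invr_ge0 ltW.
have -> : lam / N * (p%:R ^+ 2 * C * N * (D * (d + w))) =
   lam * p%:R ^+ 2 * C * (D * (d + w)) by field; rewrite gt_eqF.
have -> : lam / N * (p%:R ^+ 3 * C * N * d ^+ 3 + Cg * d) =
   lam * p%:R ^+ 3 * C * d ^+ 3 + lam * Cg * (d * N^-1) by field; rewrite gt_eqF.
have a0 : 0 <= lam * p%:R ^+ 2 * C by nonneg.
have b0 : 0 <= lam * p%:R ^+ 3 * C by nonneg.
have e0 : 0 <= lam * Cg by rewrite mulr_ge0.
have k1 : lam * p%:R ^+ 2 * C <= expansion_const.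
  rewrite /expansion_const -addrA mulrDr mulr1 -addrA lerDl !addr_ge0//.
  by rewrite mulr_ge0.
have k2 : lam * p%:R ^+ 3 * C <= expansion_const.
  by rewrite /expansion_const addrAC lerDr addr_ge0// mulr_ge0// addr_ge0.
have k3 : lam * Cg <= expansion_const.
  by rewrite /expansion_const lerDr addr_ge0// mulr_ge0// addr_ge0.
rewrite [leLHS]addrA [leRHS]mulrDr [X in _ <= X + _]mulrDr; apply: lerD; first apply: lerD.
- by rewrite ler_wpM2r// mulr_ge0// addr_ge0.
- by rewrite ler_wpM2r// exprn_ge0.
by rewrite ler_wpM2r// mulr_ge0.
Qed.

Lemma second_order_term_le (v : V) : `|second_order_term v| <=
  (1 + expansion_const) * (`|v| + `|v| ^+ 2 + N^-1).
Proof.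
have iN : 0 <= N^-1 by rewrite invr_ge0 ltW.
set w := `|v|; have w0 : 0 <= w by exact: normr_ge0.
have H1 : `|2^-1 *: (third_form (v^T *m v - invmx A) *m invmx A)| <=
   lam / N * (p%:R ^+ 2 * C * N * (w ^+ 2 + lam / N)).
  apply: le_trans (halfZ_le _) _; apply: le_trans (invA_row _) _.
  apply: ler_wpM2l; first by nonneg.
  apply: le_trans (third_form_le _ thn) _; apply: ler_wpM2l; first by nonneg.
  apply: le_trans (ler_normB _ _) _; rewrite lerD//.
    by rewrite expr2; exact: rank_one_norm.
  by rewrite -lamN; exact: coercive_invmx.
apply: le_trans (ler_normB _ _) _; rewrite mulrDl mul1r; apply: lerD.
  by rewrite -addrA lerDl addr_ge0// exprn_ge0.
apply: le_trans H1 _.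
have -> : lam / N * (p%:R ^+ 2 * C * N * (w ^+ 2 + lam / N)) =
   lam * p%:R ^+ 2 * C * (w ^+ 2 + lam * N^-1) by field; rewrite gt_eqF.
have a0 : 0 <= lam * p%:R ^+ 2 * C by nonneg.
have w2 : 0 <= w ^+ 2 by rewrite exprn_ge0.
apply: le_trans (_ : lam * p%:R ^+ 2 * C * (1 + lam) * (w + w ^+ 2 + N^-1) <= _).
  rewrite -[leRHS]mulrA ler_wpM2l//.
  move: (N^-1) (w ^+ 2) iN w2 lam0 => n ww iN w2 l1.
  have := mulr_ge0 l1 w2; have := mulr_ge0 l1 w0; nra.
rewrite ler_wpM2r ?addr_ge0// /expansion_const -addrA lerDl addr_ge0//.
  by nonneg.
by rewrite mulr_ge0.
Qed.

End Root.
End Expansion.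

(** * Scalar inequalities used to integrate the error *)

Section ScalarBounds.
Variable R : realType.

(* To be read with d = |delta|, w = |u|, D = |delta - u|, X = |delta - V|. *)
Lemma good_event_bound (E : R) : 0 <= E -> exists2 B, 0 <= B &
  forall e N d w D X : R, 0 < e -> e <= 1 -> 1 <= N -> 0 <= d -> d <= e -> 0 <= w ->
  0 <= D -> E * e <= 2^-1 -> d <= w + D -> D <= E * (d ^+ 2 + N^-1) ->
  X <= E * (D * (d + w) + d ^+ 3 + d / N) ->
  N * X <= B * (e * (1 + N ^+ 2 * w ^+ 4) + (e * N)^-1).
Proof.
(* With n = 1/N: from d <= w + E (d^2 + n), d^2 <= e d and E e <= 1/2 follows d <= F (w + n).
   Reinserting this in the bound on D gives D <= G (e w + n). *)
move=> E0; pose F := 2 + 2 * E; pose G := E * (F + 1).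
have F0 : 0 <= F by rewrite /F; nonneg.
have G0 : 0 <= G by rewrite /G; nonneg.
exists (E * (3 * G * (F + 1) + 2 * F ^+ 2 + 2 * F)); first by nonneg.
move=> e N d w D X e0 e1 N1 d0 de w0 D0 Ee dwD DE XE.
have Np : 0 < N by rewrite (lt_le_trans ltr01).
set n := N^-1 in DE *; have n0 : 0 < n by rewrite invr_gt0.
have n1 : n <= 1 by rewrite invf_le1.
have e0' := ltW e0; have n0' := ltW n0.
(* The remainder of the weighted AM-GM inequality w n <= e w^2 + n^2 / e, to which all mixed terms
   are reduced. *)
pose m := n ^+ 2 / e; have m0 : 0 <= m by rewrite /m; nonneg.
have mn : n ^+ 2 <= m by rewrite /m ler_pdivlMr// ler_piMr// exprn_ge0.
have wn : w * n <= e * w ^+ 2 + m.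
  have -> : e * w ^+ 2 + m = ((e * w - n) ^+ 2 + 2 * (w * n * e)) / e.
    by rewrite /m; field; rewrite gt_eqF.
  rewrite ler_pdivlMr//.
  have := sqr_ge0 (e * w - n); have : 0 <= w * n * e by nonneg.
  lra.
have d2e : d ^+ 2 <= e * d by rewrite expr2 ler_wpM2r.
have dF : d <= F * (w + n).
  have H1 : E * d ^+ 2 <= 2^-1 * d.
    apply: le_trans (ler_wpM2l E0 d2e) _; rewrite mulrA; exact: ler_wpM2r.
  have H2 := mulr_ge0 E0 w0; have H3 := mulr_ge0 E0 n0'.
  rewrite /F; rewrite mulrDr in DE; lra.
have DG : D <= G * (e * w + n).
  apply: le_trans DE _; rewrite /G -mulrA ler_wpM2l//.
  have H1 : e * d <= e * (F * (w + n)) by rewrite ler_wpM2l.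
  have H2 : e * (F * n) <= F * n by rewrite ler_piMl// mulr_ge0.
  have H3 : 0 <= e * w by nonneg.
  have -> : (F + 1) * (e * w + n) = e * (F * w) + F * n + (e * w + n) by ring.
  rewrite mulrDr mulrDr in H1; lra.
have ew0 : 0 <= e * w ^+ 2 by nonneg.
have T1 : D * (d + w) <= 3 * G * (F + 1) * (e * w ^+ 2 + m).
  have H1 : d + w <= (F + 1) * (w + n) by rewrite mulrDl mul1r lerD// lerDl.
  apply: le_trans (ler_pM D0 (addr_ge0 d0 w0) DG H1) _.
  have -> : G * (e * w + n) * ((F + 1) * (w + n)) =
    G * (F + 1) * (e * w ^+ 2 + e * (w * n) + w * n + n ^+ 2) by ring.
  have -> : 3 * G * (F + 1) * (e * w ^+ 2 + m) = G * (F + 1) * (3 * (e * w ^+ 2 + m)) by ring.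
  apply: ler_wpM2l; first by nonneg.
  have : e * (w * n) <= w * n by rewrite ler_piMl// mulr_ge0.
  lra.
have T2 : d ^+ 3 <= 2 * F ^+ 2 * (e * w ^+ 2 + m).
  have H1 : d ^+ 2 <= (F * (w + n)) ^+ 2.
    by rewrite ler_sqr ?nnegrE//; nonneg.
  have H2 : d ^+ 3 <= e * (F * (w + n)) ^+ 2.
    by rewrite exprS ler_pM// exprn_ge0.
  apply: le_trans H2 _.
  have -> : e * (F * (w + n)) ^+ 2 = F ^+ 2 * (e * (w + n) ^+ 2) by ring.
  have -> : 2 * F ^+ 2 * (e * w ^+ 2 + m) = F ^+ 2 * (2 * (e * w ^+ 2 + m)) by ring.
  apply: ler_wpM2l; first by nonneg.
  have H3 : e * n ^+ 2 <= m by apply: le_trans mn; rewrite ler_piMl// exprn_ge0.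
  have H4 : 0 <= e * (w - n) ^+ 2 by rewrite mulr_ge0// sqr_ge0.
  have E4 : e * (w - n) ^+ 2 = e * w ^+ 2 - 2 * (e * w * n) + e * n ^+ 2 by ring.
  have -> : e * (w + n) ^+ 2 = e * w ^+ 2 + 2 * (e * w * n) + e * n ^+ 2 by ring.
  rewrite E4 in H4; lra.
have T3 : d / N <= 2 * F * (e * w ^+ 2 + m).
  rewrite -/n; apply: le_trans (ler_wpM2r n0' dF) _.
  have -> : F * (w + n) * n = F * (w * n + n ^+ 2) by ring.
  have -> : 2 * F * (e * w ^+ 2 + m) = F * (2 * (e * w ^+ 2 + m)) by ring.
  apply: ler_wpM2l => //; lra.
have XB : X <= E * (3 * G * (F + 1) + 2 * F ^+ 2 + 2 * F) * (e * w ^+ 2 + m).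
  apply: le_trans XE _; rewrite -mulrA ler_wpM2l//.
  set P := e * w ^+ 2 + m.
  have -> : (3 * G * (F + 1) + 2 * F ^+ 2 + 2 * F) * P =
    3 * G * (F + 1) * P + 2 * F ^+ 2 * P + 2 * F * P by ring.
  by apply: lerD => //; apply: lerD.
apply: le_trans (ler_wpM2l (ltW Np) XB) _.
rewrite mulrCA; apply: ler_wpM2l; first by nonneg.
have -> : N * (e * w ^+ 2 + m) = e * (N * w ^+ 2) + (e * N)^-1.
  by rewrite /m /n; field; rewrite !gt_eqF.
rewrite lerD2r ler_wpM2l//.
(* N w^2 <= 1 + (N w^2)^2 passes to the fourth moment, so that the good and bad data share one
   envelope. *)
have -> : N ^+ 2 * w ^+ 4 = (N * w ^+ 2) ^+ 2 by ring.
have := sqr_ge0 (N * w ^+ 2 - 1); rewrite sqrrB expr1n mulr1.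
have : 0 <= N * w ^+ 2 by nonneg.
lra.
Qed.

(** Weighted AM-GM again, with most of the loss put into the constant N / e, which is later
    multiplied by the small probability of the bad event. *)
Lemma bad_event_bound (E e N w v : R) : 0 <= E -> 0 < e -> e <= 1 -> 1 <= N -> 0 <= w ->
  v <= (1 + E) * (w + w ^+ 2 + N^-1) ->
  N * v <= 3 * (1 + E) * (e * (1 + N ^+ 2 * w ^+ 4) + N / e).
Proof.
move=> E0 e0 e1 N1 w0 vE.
have Np : 0 < N by rewrite (lt_le_trans ltr01).
have e0' := ltW e0; have Np' := ltW Np.
apply: le_trans (ler_wpM2l Np' vE) _.
have -> : N * ((1 + E) * (w + w ^+ 2 + N^-1)) = (1 + E) * (N * w + N * w ^+ 2 + 1).
  by field; rewrite gt_eqF.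
have -> : 3 * (1 + E) * (e * (1 + N ^+ 2 * w ^+ 4) + N / e) =
  (1 + E) * (3 * (e * (1 + N ^+ 2 * w ^+ 4) + N / e)) by ring.
apply: ler_wpM2l; first by nonneg.
set z := N * w ^+ 2; have z0 : 0 <= z by rewrite /z; nonneg.
have -> : N ^+ 2 * w ^+ 4 = z ^+ 2 by rewrite /z; ring.
have Ne : 1 <= N / e by rewrite ler_pdivlMr// mul1r (le_trans e1).
have ei : e^-1 <= N / e by rewrite ler_peMl// invr_ge0.
have H1 : N * w <= e * z + N / e.
  have -> : e * z + N / e = N * ((e * w - 1) ^+ 2 + 2 * (w * e)) / e.
    by rewrite /z; field; rewrite gt_eqF.
  rewrite ler_pdivlMr// -mulrA ler_wpM2l//.
  have := sqr_ge0 (e * w - 1); have : 0 <= w * e by nonneg.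
  lra.
have H2 : z <= e * z ^+ 2 + e^-1.
  have -> : e * z ^+ 2 + e^-1 = ((e * z - 1) ^+ 2 + 2 * (z * e)) / e.
    by field; rewrite gt_eqF.
  rewrite ler_pdivlMr//.
  have := sqr_ge0 (e * z - 1); have : 0 <= z * e by nonneg.
  lra.
have H3 : e * z <= e * (1 + z ^+ 2).
  rewrite ler_wpM2l//; have := sqr_ge0 (z - 1); rewrite sqrrB expr1n mulr1; lra.
have H4 : 0 <= e * z ^+ 2 by nonneg.
rewrite mulrDr mulr1 in H3 *; lra.
Qed.

Lemma pow4_le_exp (y : R) : y ^+ 4 <= 4 ^+ 4 * (expR y + expR (- y)).
Proof.
wlog y0 : y / 0 <= y.
  move=> H; have [/H//|/ltW yn] := leP 0 y.
  by have := H (- y); rewrite oppr_ge0 opprK [expR (- y) + _]addrC exprNn /= -signr_odd expr0 mul1r; apply.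
apply: le_trans (_ : 4 ^+ 4 * expR y <= _); last by rewrite ler_wpM2l ?exprn_ge0// lerDl expR_ge0.
have y4 : 0 <= y / 4 by rewrite divr_ge0.
have H : y / 4 <= expR (y / 4) by apply: le_trans (expR_ge1Dx _); rewrite lerDr.
have : (y / 4) ^+ 4 <= expR (y / 4) ^+ 4 by rewrite lerXn2r// nnegrE ?expR_ge0.
rewrite -expRM_natl.
have -> : 4%:R * (y / 4) = y by field.
move=> H4; rewrite -{1}[y](divfK (_ : 4 != 0))// exprMn mulrC ler_wpM2l// exprn_ge0.
Qed.

Lemma norm_pow_le_sum p (v : 'rV[R]_p) k : `|v| ^+ k.+1 <= \sum_i `|v ord0 i| ^+ k.+1.
Proof.
have [v0|] := eqVneq (mx_norm v) 0.
  by rewrite [`|v|]v0 expr0n /=; apply: sumr_ge0 => i _; rewrite exprn_ge0.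
move=> /mx_norm_neq0[[j i]]; rewrite (ord1 j) /= => vi.
rewrite [`|v|]vi (bigD1 i)//= lerDl; apply: sumr_ge0 => l _; exact: exprn_ge0.
Qed.

End ScalarBounds.

Lemma sum_delta (R : realType) (p : nat) (l : 'I_p) (f : 'I_p -> R) :
  \sum_i (delta_mx ord0 l : 'rV[R]_p) ord0 i * f i = f l.
Proof.
transitivity (dotr (delta_mx ord0 l) (\row_i f i)); last by rewrite dotr_delta mxE.
by apply: eq_bigr => i _; rewrite [in RHS]mxE.
Qed.

(** * First-order condition for the MML estimate *)

Section StationaryPoint.
Variables (R : realType) (p : nat) (D : set 'rV[R]_p).
Variables (K2 : 'I_p -> 'I_p -> 'rV[R]_p -> R) (K3 : 'I_p -> 'I_p -> 'I_p -> 'rV[R]_p -> R).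
Variables (loglik : 'rV[R]_p -> R) (sc : 'I_p -> 'rV[R]_p -> R).
Hypothesis dK2 : forall i l, has_grad D (K2 i l) (fun j => K3 j i l).
Hypothesis dlik : has_grad D loglik sc.

(** Fermat's rule on the coordinate line through [t], with [is_derive_ln_det] supplying the
    derivative of the penalty. *)
Lemma stationary_penalized (t : 'rV[R]_p) (r : R) : 0 < r ->
  (forall u, `|u - t| < r -> [/\ D u, 0 < \det (info K2 u) &
    2^-1 * ln (\det (info K2 u)) + loglik u <=
    2^-1 * ln (\det (info K2 t)) + loglik t]) ->
  forall l, sc l t + 2^-1 * grad_logdet K2 K3 l t = 0.
Proof.
move=> r0 near_t l.
pose e : 'rV[R]_p := delta_mx ord0 l.
have near_line (s : R) : s \in `](-r), r[ -> `|(t + s *: e) - t| < r.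
  rewrite in_itv /= -ltr_norml => sr; rewrite addrAC subrr add0r normrZ.
  by apply: le_lt_trans sr; rewrite ler_piMr// norm_delta_le.
pose f1 (s : R) : R := ln (\det (info K2 (t + s *: e))).
pose f2 (s : R) : R := loglik (t + s *: e).
pose df1 (s : R) : R := grad_logdet K2 K3 l (t + s *: e).
pose df2 (s : R) : R := \sum_i e ord0 i * sc i (t + s *: e).
have d1 (s : R) : s \in `](-r), r[ -> is_derive s 1 f1 (df1 s).
  move=> /near_line/near_t[Ds det0 _].
  pose dA := \matrix_(i, j) K3 l i j (t + s *: e).
  have H := @is_derive_ln_det R p (fun s => info K2 (t + s *: e)) dA s _ det0.
  apply: is_derive_eq (H _) _.
    move=> i j; rewrite [dA i j]mxE.
    have -> : (fun s => info K2 (t + s *: e) i j) = (fun s => K2 i j (t + s *: e)).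
      by apply/funext => y; exact: infoE.
    apply: (@is_derive_line _ _ (K2 i j) t e s).
    apply: is_derive_eq (dK2 i j Ds e) _.
    exact: sum_delta.
  by apply: eq_bigr => i _; apply: eq_bigr => j _; rewrite mxE.
have d2 (s : R) : s \in `](-r), r[ -> is_derive s 1 f2 (df2 s).
  move=> /near_line/near_t[Ds _ _].
  by apply: (@is_derive_line _ _ loglik t e s); exact: dlik.
have r00 : (0 : R) \in `](-r), r[ by rewrite in_itv /= oppr_lt0 r0.
pose F := 2^-1 \*: f1 + f2.
have dF (s : R) : s \in `](-r), r[ -> is_derive s 1 F (2^-1 *: df1 s + df2 s).
  by move=> sI; apply: is_deriveD; [apply: is_deriveZ; exact: d1|exact: d2].
have rr : - r <= r by rewrite ge0_cp// ltW.
have derF (s : R) : s \in `](-r), r[ -> derivable F s 1 by move=> /dF[].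
have maxF (s : R) : s \in `](-r), r[ -> F s <= F 0.
  move=> sI; have [_ _ H] := near_t _ (near_line _ sI).
  have F0 : F 0 = 2^-1 * ln (\det (info K2 t)) + loglik t.
    by rewrite -[LHS]/(2^-1 * f1 0 + f2 0) /f1 /f2 scale0r addr0.
  by rewrite F0; exact: H.
have max0 := @derive1_at_max R F (-r) r 0 rr derF r00 maxF.
have [_ E1] := max0; have [_ E2] := dF 0 r00.
rewrite E1 in E2; rewrite E2 /df1 /df2 scale0r addr0 addrC.
by congr (_ + _); rewrite sum_delta.
Qed.

End StationaryPoint.

Section EstimatingEquation.
Variables (R : realType) (p : nat) (M : exp_family R p) (Theta : set 'rV[R]_p).
Hypotheses (Theta_open : open Theta) (Theta_nat : Theta `<=` natural_space M).
Local Notation K := (@log_partition R p M).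

Definition cumulant2 i l := partials [:: i; l] K.
Definition cumulant3 j i l := partials [:: j; i; l] K.

Lemma info_fisher t : Theta t -> info cumulant2 t = fisher_info M t.
Proof.
move=> Tt; apply/matrixP => i j.
by rewrite infoE (fisher_infoE Theta_open Theta_nat).
Qed.

(** The ball around [t] makes the maximizer interior and keeps the determinant positive, so that the
    logarithm of the prior splits into a constant and a log-determinant. *)
Lemma mml_estimating_eq (h : 'rV[R]_p -> R) (k : R) (x : ef_space M) (t : 'rV[R]_p) (r : R) :
  0 < k -> (forall u, Theta u -> h u = k * \det (fisher_info M u)) ->
  0 < ef_carrier x -> 0 < r ->
  (forall u, `|u - t| < r -> Theta u /\ 0 < \det (info cumulant2 u)) ->
  is_argmax Theta (mml_objective h x) t ->
  forall l, centered t l x + 2^-1 * grad_logdet cumulant2 cumulant3 l t = 0.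
Proof.
move=> k0 hE c0 r0 near_t [Tt tmax].
have objE u : `|u - t| < r -> mml_objective h x u =
    ln k + (2^-1 * ln (\det (info cumulant2 u)) +
            (ln (ef_carrier x) + (dotr u (ef_stat x) - K u))).
  move=> /near_t[Tu det0].
  rewrite /mml_objective (hE _ Tu) -(info_fisher Tu) lnM ?posrE// (ln_density _ c0).
  have alg (a b d : R) : a + b + d - 2^-1 * b = a + (2^-1 * b + d) by field.
  exact: alg.
have dK2 i j : has_grad Theta (cumulant2 i j) (fun l => cumulant3 l i j).
  exact: has_grad_partials Theta_open Theta_nat [:: i; j].
apply: (stationary_penalized dK2 (has_grad_log_density Theta_open Theta_nat x) r0).
move=> u ur; have [Tu det0] := near_t _ ur; split; [exact: Tu|exact: det0|].
have tt : `|t - t| < r by rewrite subrr normr0.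
have := tmax _ Tu; rewrite (objE u ur) (objE t tt) lerD2l; exact: id.
Qed.

End EstimatingEquation.

(** * Moments of the score *)

Section MeanZero.
Variables (R : realType) (p : nat) (M : exp_family R p) (t : 'rV[R]_p).
Implicit Types g h : ef_space M -> R.

(** Integrability is bundled in because [expect] is linear only on integrable functions; linear
    combinations then need no side conditions. *)
Definition mean_zero g := integrable_under t g /\ expect t g = 0.

Lemma eq_mean_zero g h : g =1 h -> mean_zero g -> mean_zero h.
Proof. by move=> /funext ->. Qed.

Lemma mean_zeroD g h : mean_zero g -> mean_zero h -> mean_zero (fun x => g x + h x).
Proof.
move=> [ig eg] [ih eh]; split; first exact: integrable_underD.
by rewrite expectD// eg eh addr0.
Qed.

Lemma mean_zeroZ (a : R) g : mean_zero g -> mean_zero (fun x => a * g x).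
Proof.
move=> [ig eg]; split; first exact: integrable_underZ.
by rewrite expectZ// eg mulr0.
Qed.

Lemma mean_zero_sum n (g : 'I_n -> ef_space M -> R) :
  (forall i, mean_zero (g i)) -> mean_zero (fun x => \sum_i g i x).
Proof.
move=> H; split; first by apply: integrable_under_sum => i; case: (H i).
by rewrite expect_sum => [|i]; [rewrite big1// => i _|]; case: (H i).
Qed.

Variables (K2 : 'I_p -> 'I_p -> 'rV[R]_p -> R) (K3 : 'I_p -> 'I_p -> 'I_p -> 'rV[R]_p -> R).
Variables (theta : 'rV[R]_p) (S : ef_space M -> 'rV[R]_p).
Local Notation A := (info K2 theta).

Lemma mean_zero_second_order_term :
  A \in unitmx -> A^T = A ->
  (forall k, mean_zero (fun x => S x ord0 k)) ->
  (forall k m, mean_zero (fun x => S x ord0 k * S x ord0 m - A k m)) ->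
  forall i, mean_zero (fun x => second_order_term K2 K3 theta (S x *m invmx A) ord0 i).
Proof.
move=> uA symA S1 S2 i; set B := invmx A.
have mz1 j : mean_zero (fun x => (S x *m B) ord0 j).
  apply: (@eq_mean_zero (fun x => \sum_k B k j * S x ord0 k)) => [x|].
    by rewrite mxE; apply: eq_bigr => k _; rewrite mulrC.
  by apply: mean_zero_sum => k; exact: mean_zeroZ.
pose X x := (S x *m B)^T *m (S x *m B) - B.
have mzX a b : mean_zero (fun x => X x a b).
  apply: (@eq_mean_zero (fun x => \sum_m B m b * \sum_k B k a *
      (S x ord0 k * S x ord0 m - A k m))) => [x|]; last first.
    by apply: mean_zero_sum => m; apply: mean_zeroZ; apply: mean_zero_sum => k; exact: mean_zeroZ.
  (* Symmetry of [A] gives B^T A B = B, so the centered square of u is a fixed congruence of the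
     centered square of the score. *)
  have -> : X x = B^T *m ((S x)^T *m S x - A) *m B.
    rewrite /X mulmxBr mulmxBl trmx_mul !mulmxA; congr (_ - _).
    by rewrite -mulmxA mulmxV// mulmx1 /B trmx_inv symA.
  rewrite mxE; apply: eq_bigr => m _; rewrite mxE mulrC; congr (_ * _).
  apply: eq_bigr => k _; congr (_ * _); first by rewrite [RHS]mxE.
  rewrite [RHS]mxE [X in _ = _ + X]mxE; congr (_ - _).
  by rewrite [RHS]mxE big_ord1 [(S x)^T _ _]mxE.
apply: (@eq_mean_zero (fun x => (S x *m B) ord0 i + - 2^-1 * \sum_l B l i *
    \sum_a \sum_b K3 l b a theta * X x a b)) => [x|].
  rewrite /second_order_term -/B -/(X x) [RHS]mxE [X in _ = _ + X]mxE mulNr.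
  congr (_ - _); rewrite [RHS]mxE; congr (_ * _).
  rewrite [RHS]mxE; apply: eq_bigr => l _; rewrite mulrC; congr (_ * _).
  by rewrite [RHS]mxE; apply: eq_bigr => a _; apply: eq_bigr => b _; rewrite mulrC.
apply: mean_zeroD => //; apply: mean_zeroZ; apply: mean_zero_sum => l; apply: mean_zeroZ.
by apply: mean_zero_sum => a; apply: mean_zero_sum => b; exact: mean_zeroZ.
Qed.

End MeanZero.

Section ExponentialMoments.
Variables (R : realType) (p : nat) (M : exp_family R p) (Theta : set 'rV[R]_p).
Hypotheses (Theta_open : open Theta) (Theta_nat : Theta `<=` natural_space M).
Local Notation K := (@log_partition R p M).
Variables (theta : 'rV[R]_p) (rho C N : R).
Hypotheses (rho0 : 0 < rho) (C0 : 0 <= C) (N0 : 0 < N).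
Hypothesis ball_Theta : forall t, `|t - theta| < rho -> Theta t.
Hypothesis cumulant2_le : forall i j t, `|t - theta| < rho ->
  `|cumulant2 M i j t| <= C * N.

Lemma has_gradS (D D' : set 'rV[R]_p) f g : D' `<=` D -> has_grad D f g -> has_grad D' f g.
Proof. by move=> DD dF t /DD; exact: dF. Qed.

Lemma log_partition_taylor (i : 'I_p) (a : R) : `|a| < rho ->
  K (theta + a *: delta_mx ord0 i) - K theta - a * partials [:: i] K theta <=
  p%:R ^+ 2 * a ^+ 2 * (C * N).
Proof.
move=> ar; pose D : set 'rV[R]_p := [set t | `|t - theta| < rho].
have DT : D `<=` Theta by move=> t; exact: ball_Theta.
pose v : 'rV[R]_p := a *: delta_mx ord0 i.
have va : `|v| <= `|a| by rewrite normrZ ler_piMr// norm_delta_le.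
have seg (s : R) : 0 <= s <= 1 -> D (theta + s *: v).
  move=> /andP[s0 s1]; rewrite /D /= addrAC subrr add0r normrZ ger0_norm//.
  by apply: le_lt_trans ar; apply: le_trans va; rewrite ler_piMl.
have d1 := has_gradS DT (has_grad_partials Theta_open Theta_nat [::]).
have d2 j : has_grad D (partials [:: j] K) (fun l => cumulant2 M l j).
  exact: has_gradS DT (has_grad_partials Theta_open Theta_nat [:: j]).
have bound j l x : D x -> `|cumulant2 M l j x| <= C * N by exact: cumulant2_le.
have T := grad_taylor2 seg d1 d2 bound.
have E : \sum_j v ord0 j * partials [:: j] K theta = a * partials [:: i] K theta.
  rewrite -(sum_delta i (fun j => partials [:: j] K theta)) mulr_sumr.
  by apply: eq_bigr => j _; rewrite mxE mulrA.
rewrite E in T; apply: le_trans (ler_norm _) (le_trans T _).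
rewrite exprMn; apply: ler_wpM2r; first by rewrite mulr_ge0// ltW.
by apply: ler_wpM2l; rewrite ?exprn_ge0// -[leRHS]real_normK ?num_real// ler_sqr ?nnegrE.
Qed.

(** By tilting, the logarithm of this expectation is the increment of [K] less its linear part,
    hence quadratic in [a]: a sub-Gaussian bound with variance of order N. *)
Lemma centered_mgf (i : 'I_p) (a : R) : `|a| < rho ->
  integrable_under theta (fun x : ef_space M => expR (a * centered theta i x)) /\
  expect theta (fun x : ef_space M => expR (a * centered theta i x)) <= expR (p%:R ^+ 2 * a ^+ 2 * (C * N)).
Proof.
move=> ar; pose t' := theta + a *: delta_mx ord0 i.
have Tt : Theta theta by apply: ball_Theta; rewrite subrr normr0.
have Tt' : Theta t'.
  apply: ball_Theta; rewrite /t' addrAC subrr add0r normrZ.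
  by apply: le_lt_trans ar; rewrite ler_piMr// norm_delta_le.
have [I E] := expect_expR Theta_open Theta_nat Tt Tt'.
set b := expR (- (a * partials [:: i] K theta)).
have fE : (fun x : ef_space M => expR (a * centered theta i x)) =
    (fun x => b * expR (dotr (t' - theta) (ef_stat x))).
  apply/funext => x; rewrite /b -expRD /centered mulrBr addrC /t'.
  by rewrite [theta + _ - theta]addrAC subrr add0r dotrZl dotr_delta.
rewrite fE; split; first exact: integrable_underZ.
rewrite expectZ// E /b -expRD ler_expR.
by apply: le_trans (log_partition_taylor i ar); rewrite addrC.
Qed.

(* Dominates |S|^4 / N^2 up to a constant; see [centered_pow4_le]. *)
Definition exp_envelope (x : ef_space M) : R :=
  \sum_i (expR ((Num.sqrt N)^-1 * centered theta i x) +
          expR (- (Num.sqrt N)^-1 * centered theta i x)).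

(** At the scale a = N^(-1/2) the exponent a^2 C N is free of N; the hypothesis keeps the shifted
    parameter in the ball. *)
Lemma expect_exp_envelope : (Num.sqrt N)^-1 < rho ->
  integrable_under theta exp_envelope /\
  expect theta exp_envelope <= 2 * p%:R * expR (p%:R ^+ 2 * C).
Proof.
move=> Nrho; set a := (Num.sqrt N)^-1.
have a0 : 0 <= a by rewrite invr_ge0 sqrtr_ge0.
have aN : a ^+ 2 * N = 1.
  by rewrite /a exprVn sqr_sqrtr ?mulVf// ?gt_eqF// ltW.
have H i b : `|b| = a -> integrable_under theta (fun x : ef_space M => expR (b * centered theta i x)) /\
    expect theta (fun x : ef_space M => expR (b * centered theta i x)) <= expR (p%:R ^+ 2 * C).
  move=> ba; have br : `|b| < rho by rewrite ba.
  have [I E] := centered_mgf i br; split => //; apply: le_trans E _.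
  have -> : b ^+ 2 = a ^+ 2 by rewrite -ba real_normK ?num_real.
  by rewrite -mulrA [a ^+ 2 * _]mulrCA aN mulr1.
have Hp i := H i a (ger0_norm a0).
have Hn i := H i (- a) (etrans (normrN a) (ger0_norm a0)).
have I i : integrable_under theta (fun x : ef_space M => expR (a * centered theta i x) +
    expR (- a * centered theta i x)).
  by apply: integrable_underD; [case: (Hp i)|case: (Hn i)].
split; first exact: integrable_under_sum.
rewrite expect_sum// [leRHS](_ : _ = \sum_(i < p) (2 * expR (p%:R ^+ 2 * C))); last first.
  by rewrite sumr_const card_ord -mulr_natl; ring.
apply: ler_sum => i _; have [[Ip Ep] [In En]] := (Hp i, Hn i).
by rewrite expectD// mulrDl mul1r lerD.
Qed.

Lemma centered_pow4_le (x : ef_space M) : `|\row_i centered theta i x| ^+ 4 <=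
  N ^+ 2 * (4 ^+ 4 * exp_envelope x).
Proof.
apply: le_trans (norm_pow_le_sum _ _) _.
rewrite /exp_envelope mulr_sumr mulr_sumr; apply: ler_sum => i _; rewrite mxE.
set s := centered theta i x; set a := (Num.sqrt N)^-1.
have sN : Num.sqrt N ^+ 4 = N ^+ 2.
  by rewrite -[4%N]/(2 * 2)%N exprM sqr_sqrtr// ltW.
have s0 : Num.sqrt N != 0 by rewrite gt_eqF// sqrtr_gt0.
have -> : `|s| ^+ 4 = N ^+ 2 * (a * s) ^+ 4.
  by rewrite exprMn /a exprVn sN mulrA divff ?mul1r ?expf_neq0 ?gt_eqF// -normrX ger0_norm// exprn_even_ge0.
by rewrite ler_wpM2l ?exprn_ge0 ?(ltW N0)// mulNr; exact: pow4_le_exp.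
Qed.

End ExponentialMoments.

(** * Bias bound for one sample size *)

Section ModelBias.
Variables (R : realType) (p : nat) (M : exp_family R p) (Theta : set 'rV[R]_p).
Hypotheses (Theta_open : open Theta) (Theta_nat : Theta `<=` natural_space M).
Local Notation K := (@log_partition R p M).
Variables (theta : 'rV[R]_p) (rho c C N e B : R).
Hypotheses (rho0 : 0 < rho) (rho1 : rho <= 1) (c0 : 0 < c) (C0 : 0 <= C) (N1 : 1 <= N).
Hypothesis rho_small : p%:R ^+ 3 * C * rho <= c / 2.
Hypothesis ball_Theta : forall t, `|t - theta| < rho -> Theta t.
Hypothesis info_coercive : coercive (c * N) (fisher_info M theta).
Hypothesis cumulants_le : forall s t, (2 <= size s <= 4)%N -> `|t - theta| < rho ->
  `|partials s K t| <= C * N.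
Hypothesis N_large : (Num.sqrt N)^-1 < rho.
Local Notation E := (expansion_const p c C).
Hypotheses (e0 : 0 < e) (e1 : e < rho) (E0 : 0 <= E) (Ee : E * e <= 2^-1).
Hypotheses (B0 : 0 <= B) (BP : forall e N d w D X : R, 0 < e -> e <= 1 -> 1 <= N ->
  0 <= d -> d <= e -> 0 <= w ->
  0 <= D -> E * e <= 2^-1 -> d <= w + D -> D <= E * (d ^+ 2 + N^-1) ->
  X <= E * (D * (d + w) + d ^+ 3 + d / N) ->
  N * X <= B * (e * (1 + N ^+ 2 * w ^+ 4) + (e * N)^-1)).
Variables (h : 'rV[R]_p -> R) (k : R) (est : ef_space M -> 'rV[R]_p) (G : set (ef_space M)).
Hypotheses (k0 : 0 < k) (hE : forall u, Theta u -> h u = k * \det (fisher_info M u)).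
Hypothesis est_measurable : forall i, measurable_fun setT (fun x => est x ord0 i).
Hypothesis G_measurable : measurable G.
Hypothesis G_argmax : forall x, G x -> is_argmax Theta (mml_objective h x) (est x).
Let far : set (ef_space M) := [set x | e < `|est x - theta|].
Hypothesis far_integrable : integrable_under theta (fun x => `|est x - theta| * \1_far x).

Let near_theta : set 'rV[R]_p := [set t | `|t - theta| < rho].
Let cumulant1 l := partials [:: l] K.
Let cumulant4 m j i l := partials [:: m; j; i; l] K.
Local Notation K2 := (cumulant2 M).
Local Notation K3 := (cumulant3 M).

Let N0 : 0 < N. Proof. exact: lt_le_trans N1. Qed.
Let near_Theta : near_theta `<=` Theta. Proof. by move=> t; exact: ball_Theta. Qed.
Let thn : near_theta theta. Proof. by rewrite /near_theta /= subrr normr0. Qed.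
Let Tt : Theta theta. Proof. exact: near_Theta. Qed.

Let dK1 l : has_grad near_theta (cumulant1 l) (fun i => K2 i l).
Proof. exact: has_gradS near_Theta (has_grad_partials Theta_open Theta_nat [:: l]). Qed.
Let dK2 i l : has_grad near_theta (K2 i l) (fun j => K3 j i l).
Proof. exact: has_gradS near_Theta (has_grad_partials Theta_open Theta_nat [:: i; l]). Qed.
Let dK3 j i l : has_grad near_theta (K3 j i l) (fun m => cumulant4 m j i l).
Proof. exact: has_gradS near_Theta (has_grad_partials Theta_open Theta_nat [:: j; i; l]). Qed.
Let K3sym l j i t : near_theta t -> K3 j i l t = K3 l j i t.
Proof.
move=> /near_Theta Ht; transitivity (partials [:: j; l; i] K t).
  exact: (partials3_swap23 Theta_open Theta_nat j i l Ht).
exact: (partials3C Theta_open Theta_nat j l i Ht).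
Qed.
Let K2_le i j t : near_theta t -> `|K2 i j t| <= C * N.
Proof. exact: (@cumulants_le [:: i; j]). Qed.
Let K3_le l j i t : near_theta t -> `|K3 l j i t| <= C * N.
Proof. exact: (@cumulants_le [:: l; j; i]). Qed.
Let K4_le m l j i t : near_theta t -> `|cumulant4 m l j i t| <= C * N.
Proof. exact: (@cumulants_le [:: m; l; j; i]). Qed.
Let info_coercive' : coercive (c * N) (info K2 theta).
Proof. by rewrite (info_fisher Theta_open Theta_nat Tt). Qed.

Let cN0 : 0 < c * N. Proof. exact: mulr_gt0. Qed.
Let A := info K2 theta.
Let S (x : ef_space M) : 'rV[R]_p := \row_i centered theta i x.
Let u x := S x *m invmx A.
Let V x := second_order_term K2 K3 theta (u x).
(** An integrable majorant of 1 + N^2 |u|^4 whose expectation is bounded uniformly in N. *)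
Let Y (x : ef_space M) : R := 1 + (p%:R / c) ^+ 4 * 4 ^+ 4 * exp_envelope theta N x.

Let u_le x : 1 + N ^+ 2 * `|u x| ^+ 4 <= Y x.
Proof.
rewrite lerD2l; have H := coercive_invmx_row (S x) cN0 info_coercive'.
have H4 : `|u x| ^+ 4 <= (p%:R / (c * N) * `|S x|) ^+ 4.
  apply: lerXn2r H; rewrite nnegrE; first exact: normr_ge0.
  by rewrite mulr_ge0 ?normr_ge0// divr_ge0// ltW.
have S4 := @centered_pow4_le R p M theta N N0 x.
apply: le_trans (_ : N ^+ 2 * ((p%:R / (c * N)) ^+ 4 * (N ^+ 2 * (4 ^+ 4 * exp_envelope theta N x))) <= _).
  apply: ler_wpM2l; first by rewrite exprn_ge0// ltW.
  apply: le_trans H4 _; rewrite exprMn; apply: ler_wpM2l => //.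
  by rewrite exprn_ge0// divr_ge0// ltW.
have alg (q s a n z : R) : n != 0 ->
  n ^+ 2 * ((q * (a^-1 * n^-1)) ^+ 4 * (n ^+ 2 * (s * z))) = (q / a) ^+ 4 * s * z.
  move=> n0; rewrite !exprMn !exprVn.
  have -> : n ^+ 2 * (q ^+ 4 * ((a ^+ 4)^-1 * (n ^+ 4)^-1) * (n ^+ 2 * (s * z))) =
    (n ^+ 4 * (n ^+ 4)^-1) * (q ^+ 4 * (a ^+ 4)^-1 * s * z) by ring.
  by rewrite divff ?expf_neq0// mul1r.
by rewrite invfM alg// gt_eqF.
Qed.

Let Y0 x : 0 <= Y x.
Proof.
apply: le_trans (u_le x); rewrite addr_ge0// mulr_ge0// exprn_ge0// ltW//.
Qed.

Let good_bound x : 0 < ef_carrier x -> G x -> `|est x - theta| <= e ->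
  N * `|est x - theta - V x| <= B * (e * Y x + (e * N)^-1).
Proof.
move=> cx Gx de.
have tn : near_theta (est x) by exact: le_lt_trans de e1.
(* The ball of this radius around the estimate lies in the ball of radius [rho] around [theta], so
   the maximizer is interior. *)
have r0 : 0 < rho - `|est x - theta| by rewrite subr_gt0.
have cN2 : 0 < c * N / 2 by rewrite divr_gt0.
have near_det v : `|v - est x| < rho - `|est x - theta| -> Theta v /\ 0 < \det (info K2 v).
  move=> vr; have vn : near_theta v.
    rewrite /near_theta /= -(subrKA (est x)).
    by apply: le_lt_trans (ler_normD _ _) _; rewrite -ltrBrDr.
  split; first exact: near_Theta.
  exact: (coercive_det_gt0 cN2 (info_near_coercive C0 N0 rho_small dK2 K3_le info_coercive' vn)).
have foc := mml_estimating_eq Theta_open Theta_nat k0 hE cx r0 near_det (G_argmax Gx).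
have eqn l : S x ord0 l = cumulant1 l (est x) - cumulant1 l theta -
    2^-1 * grad_logdet K2 K3 l (est x).
  have alg (s a b g : R) : (s - a) + g = 0 -> s - b = a - b - g.
    by move=> H; apply/eqP; rewrite -subr_eq0 -H; apply/eqP; ring.
  by rewrite mxE; exact: alg (foc l).
have D1 := first_order_le c0 C0 N0 rho1 rho_small dK1 dK2 dK3 K3sym K3_le K4_le info_coercive' tn eqn.
have D2 := second_order_le c0 C0 N0 rho1 rho_small dK1 dK2 dK3 K3sym K3_le K4_le info_coercive' tn eqn.
have dwD : `|est x - theta| <= `|u x| + `|est x - theta - u x|.
  by rewrite -{1}(subrK (u x) (est x - theta)) addrC ler_normD.
have e1' : e <= 1 by rewrite (le_trans (ltW e1)).
have H := BP e0 e1' N1 (normr_ge0 _) de (normr_ge0 _) (normr_ge0 _) Ee dwD D1 D2.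
apply: le_trans H _; apply: ler_wpM2l => //; rewrite lerD2r; apply: ler_wpM2l => //.
exact: ltW.
Qed.

Let V_bound x : N * `|V x| <= 3 * (1 + E) * (e * Y x + N / e).
Proof.
have e1' : e <= 1 by rewrite (le_trans (ltW e1)).
have H := second_order_term_le c0 C0 N0 K3_le info_coercive' thn (u x).
apply: le_trans (bad_event_bound E0 e0 e1' N1 (normr_ge0 _) H) _.
apply: ler_wpM2l; first by nonneg.
by rewrite lerD2r ler_wpM2l ?(ltW e0).
Qed.

(** The square of [e] comes from the far data: there N / e is charged to N |est - theta|, which
    exceeds N e, at the cost of another 1 / e. *)
Let kap : R := 1 + 3 * (1 + E) / e ^+ 2.
Let Dom x := (B + 3 * (1 + E)) * (e * Y x + (e * N)^-1) +
  kap * (N * (\1_(~` G) x + `|est x - theta| * \1_far x)).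

(** Near data in [G] follow the expansion; near data outside [G] are charged to the indicator, and
    far data to their own error. *)
Let dominated_pointwise x : 0 < density theta x ->
  N * `|est x - theta - V x| <= Dom x.
Proof.
rewrite density_gt0 => cx.
have e1' : e <= 1 by rewrite (le_trans (ltW e1)).
have Ne0 : 0 <= (e * N)^-1 by rewrite invr_ge0 mulr_ge0 ?(ltW e0) ?(ltW N0).
have EY : 0 <= e * Y x by rewrite mulr_ge0 ?(ltW e0).
have E3 : 0 <= 3 * (1 + E) by nonneg.
have e20 : 0 < e ^+ 2 by rewrite exprn_gt0.
have kap0 : 0 <= kap by rewrite /kap addr_ge0// divr_ge0// ltW.
have N0' := ltW N0.
set d := `|est x - theta|; have d0 : 0 <= d by exact: normr_ge0.
have main0 : 0 <= (B + 3 * (1 + E)) * (e * Y x + (e * N)^-1).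
  by rewrite mulr_ge0// addr_ge0.
have bad : N * `|est x - theta - V x| <= N * d + 3 * (1 + E) * (e * Y x + N / e).
  apply: le_trans (ler_wpM2l N0' (ler_normB _ _)) _.
  by rewrite mulrDr lerD2l V_bound.
have bad1 : 3 * (1 + E) * (e * Y x) <= (B + 3 * (1 + E)) * (e * Y x + (e * N)^-1).
  by rewrite ler_pM// ?lerDr// lerDl.
rewrite /Dom !indicE.
have [de|ed] := leP d e.
  have -> : (x \in far) = false by apply/negbTE; rewrite notin_setE /far /= => /lt_geF; rewrite de.
  have [xG|xG] := boolP (x \in ~` G); rewrite /= ?mulr0n ?mulr0 ?addr0 ?mulr0 ?mulr1.
    apply: le_trans bad _.
    have H1 : N * d + 3 * (1 + E) * (N / e) <= kap * N.
      rewrite /kap [leRHS]mulrDl [1 * N]mul1r; apply: lerD.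
        by rewrite ler_piMr// (le_trans de).
      rewrite -!mulrA; apply: ler_wpM2l => //; apply: ler_wpM2l; first by nonneg.
      by rewrite mulrC ler_wpM2r// lef_pV2 ?posrE// expr2 ler_piMr// ltW.
    rewrite [3 * _ * (_ + _)]mulrDr; lra.
  rewrite notin_setE /= in xG; have {}xG : G x by apply: contrapT.
  apply: le_trans (good_bound cx xG de) _.
  by rewrite addr0 [leRHS]mulrDl lerDl mulr_ge0// addr_ge0.
have -> : (x \in far) = true by exact: (mem_set (A := far) ed).
rewrite mulr1; apply: le_trans bad _.
have H1 : N * d + 3 * (1 + E) * (N / e) <= kap * (N * d).
  rewrite /kap [leRHS]mulrDl [1 * _]mul1r lerD2l -!mulrA; apply: ler_wpM2l => //; apply: ler_wpM2l; first by nonneg.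
  rewrite mulrCA ler_wpM2l// expr2 invfM -mulrA ler_peMr ?invr_ge0 ?(ltW e0)//.
  by rewrite mulrC ler_pdivlMr// mul1r ltW.
have H2 : kap * (N * d) <= kap * (N * ((x \in ~` G)%:R + d)).
  by apply: ler_wpM2l => //; apply: ler_wpM2l => //; rewrite lerDr.
rewrite [3 * _ * (_ + _)]mulrDr addrCA; apply: lerD; [exact: bad1|exact: le_trans H1 H2].
Qed.

Let coordB i x : `|(est x - theta) ord0 i| <= `|est x - theta|.
Proof. exact: ler_norm_coord. Qed.

Let indicG_integrable : integrable_under theta (\1_(~` G) : ef_space M -> R).
Proof.
apply: le_integrable_under (integrable_under_cst Theta_open Theta_nat 1 Tt).
  by apply: measurable_indic; exact: measurableC.
by move=> x _; rewrite indicE; case: (_ \in _); rewrite ?normr1 ?normr0.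
Qed.

Let error_integrable i : integrable_under theta (fun x => (est x - theta) ord0 i).
Proof.
have H := integrable_underD (integrable_under_cst Theta_open Theta_nat e Tt) far_integrable.
apply: le_integrable_under H.
  rewrite (_ : (fun x => _) = (fun x => est x ord0 i - theta ord0 i)); last first.
    by apply/funext => x; rewrite !mxE.
  by apply: measurable_funB => //; exact: est_measurable.
move=> x _; apply: le_trans (coordB i x) _; rewrite indicE.
have [de|ed] := leP `|est x - theta| e.
  by rewrite -[leLHS]addr0 lerD// mulr_ge0.
have -> : (x \in far) = true by exact: (mem_set (A := far) ed).
by rewrite mulr1 lerDr ltW.
Qed.

Let symA : A^T = A.
Proof.
apply/matrixP => i j; rewrite mxE !infoE.
exact: (partials2C Theta_open Theta_nat j i Tt).
Qed.

Let V_mean_zero i : mean_zero theta (fun x => V x ord0 i).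
Proof.
apply: mean_zero_second_order_term => //.
- exact: coercive_unit cN0 info_coercive'.
- move=> a; apply: eq_mean_zero (expect_centered Theta_open Theta_nat a Tt) => x.
  by rewrite mxE.
move=> a b; have [I EK] := expect_centered2 Theta_open Theta_nat a b Tt.
have Cst := integrable_under_cst Theta_open Theta_nat (- K2 a b theta) Tt.
apply: (@eq_mean_zero _ _ _ _ (fun x => centered theta a x * centered theta b x - K2 a b theta)).
  by move=> x; rewrite [S x ord0 a]mxE [S x ord0 b]mxE infoE.
split; first exact: (integrable_underD I Cst).
rewrite (expectD I Cst) (expect_cst Theta_open Theta_nat _ Tt) EK; exact: subrr.
Qed.

(** Shaped for the limit: the first part is of order e + 1 / (e N) uniformly in the model, and for
    fixed [e] the last bracket tends to 0 by the two hypotheses on rare events. *)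
Lemma model_bias_le i : integrable_under theta (fun x => est x ord0 i) /\
  N * `|bias theta est ord0 i| <=
    (B + 3 * (1 + E)) * (e * (1 + (p%:R / c) ^+ 4 * 4 ^+ 4 * (2 * p%:R * expR (p%:R ^+ 2 * C)))
       + (e * N)^-1) +
    (1 + 3 * (1 + E) / e ^+ 2) * (N * expect theta (\1_(~` G) : ef_space M -> R) +
      N * expect theta (fun x => `|est x - theta| * \1_far x)).
Proof.
have Icst a := integrable_under_cst Theta_open Theta_nat a Tt.
have Ie : integrable_under theta (fun x => est x ord0 i).
  apply: eq_integrable_under (integrable_underD (error_integrable i) (Icst (theta ord0 i))) => x.
  by rewrite !mxE subrK.
split => //.
have -> : bias theta est ord0 i = expect theta (fun x => (est x - theta) ord0 i).
  rewrite mxE -[X in _ - X](expect_cst Theta_open Theta_nat (theta ord0 i) Tt).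
  have -> : (fun x => est x ord0 i) = (fun x => (est x - theta) ord0 i + theta ord0 i).
    by apply/funext => x; rewrite !mxE subrK.
  by rewrite (expectD (error_integrable i) (Icst _)) addrK.
have [IV EV] := V_mean_zero i.
have IVN := integrable_underZ (-1) IV.
have IZ := integrable_underZ N (integrable_underD (error_integrable i) IVN).
have [IQ EQ] := expect_exp_envelope Theta_open Theta_nat rho0 C0 N0 ball_Theta (fun i j t => @K2_le i j t) N_large.
set a1 := (p%:R / c) ^+ 4 * 4 ^+ 4.
have IaQ := integrable_underZ a1 IQ.
have IY : integrable_under theta Y := integrable_underD (Icst 1) IaQ.
have IeY := integrable_underZ e IY.
have IeY' := integrable_underD IeY (Icst (e * N)^-1).
have I1 := integrable_underZ (B + 3 * (1 + E)) IeY'.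
have Ibad := integrable_underD indicG_integrable far_integrable.
have INbad := integrable_underZ N Ibad.
have I2 := integrable_underZ kap INbad.
have IDom : integrable_under theta Dom := integrable_underD I1 I2.
have main : N * `|expect theta (fun x => (est x - theta) ord0 i)| <= expect theta Dom.
  (* V has mean zero, so subtracting it leaves the bias unchanged while making the integrand
     small. *)
  have -> : N * `|expect theta (fun x => (est x - theta) ord0 i)| =
     `|expect theta (fun x => N * ((est x - theta) ord0 i + -1 * V x ord0 i))|.
    rewrite (expectZ N (integrable_underD (error_integrable i) IVN)).
    rewrite (expectD (error_integrable i) IVN) (expectZ (-1) IV) EV mulr0 addr0.
    by rewrite normrM (ger0_norm (ltW N0)).
  apply: ler_norm_expect IZ IDom _ => x dx.
  apply: le_trans (dominated_pointwise dx).
  rewrite normrM (ger0_norm (ltW N0)); apply: ler_wpM2l; first exact: ltW.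
  apply: le_trans (ler_norm_coord (est x - theta - V x) ord0 i).
  by rewrite mulN1r [X in _ <= `|X|]mxE [X in _ <= `|_ + X|]mxE.
apply: le_trans main _.
rewrite [expect theta Dom](expectD I1 I2) (expectZ _ IeY') (expectZ _ INbad) (expectZ _ Ibad).
rewrite (expectD IeY (Icst _)) (expectZ _ IY) (expectD (Icst _) IaQ) (expectZ _ IQ).
rewrite (expectD indicG_integrable far_integrable) !(expect_cst Theta_open Theta_nat _ Tt).
rewrite -mulrDr lerD2r; apply: ler_wpM2l; first by nonneg.
rewrite lerD2r; apply: ler_wpM2l; first exact: ltW.
rewrite lerD2l; apply: ler_wpM2l => //.
by rewrite /a1 mulr_ge0 ?exprn_ge0// divr_ge0// ltW.
Qed.

End ModelBias.

(** * Asymptotics *)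

Lemma expansion_const_ge0 (R : realType) (p : nat) (c C : R) :
  0 < c -> 0 <= C -> 0 <= expansion_const p c C.
Proof. by move=> c0 C0; rewrite /expansion_const; nonneg. Qed.

Section RestrictedExpectation.
Variables (R : realType) (p : nat) (M : exp_family R p) (t : 'rV[R]_p).
Local Notation mu := (ef_base M).

Lemma measurable_norm_rV (f : ef_space M -> 'rV[R]_p) :
  (forall i, measurable_fun setT (fun x => f x ord0 i)) ->
  measurable_fun setT (fun x => `|f x|).
Proof.
move=> mf.
have -> : (fun x => `|f x|) = (fun x => \big[Order.max/0]_ij `|f x ij.1 ij.2|).
  by apply/funext => x; rewrite [LHS]mx_normrE.
elim: (index_enum _) => [|[j i] s IH].
  rewrite (_ : (fun _ => _) = cst 0); first exact: measurable_cst.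
  by apply/funext => x; rewrite big_nil.
rewrite (_ : (fun _ => _) = (fun x => Order.max `|f x j i| (\big[Order.max/0]_(ij <- s) `|f x ij.1 ij.2|))).
  apply: measurable_maxr => //; apply: measurableT_comp => //.
  by rewrite (ord1 j); exact: mf.
by apply/funext => x; rewrite big_cons.
Qed.

(** Bridge from the extended-real integrals of the asymptotic hypotheses to [expect]; finiteness
    must be known first, as real integrals send infinity to a default. *)
Lemma expect_restrict (D : set (ef_space M)) (g : ef_space M -> R) :
  measurable D -> measurable_fun setT g -> (forall x, 0 <= g x) ->
  (\int[mu]_(x in D) (g x * density t x)%:E < +oo)%E ->
  integrable_under t (fun x => g x * \1_D x) /\
  ((expect t (fun x => g x * \1_D x))%:E = \int[mu]_(x in D) (g x * density t x)%:E)%E.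
Proof.
move=> mD mg g0 Ioo.
have fE : ((fun x => (g x * density t x)%:E) \_ D) =
    (fun x => (g x * \1_D x * density t x)%:E).
  apply/funext => x; rewrite patchE indicE.
  by case: ifP => _; rewrite /= ?mulr1 ?mulr0n ?mulr0 ?mul0r.
have IE : (\int[mu]_(x in D) (g x * density t x)%:E =
    \int[mu]_x (g x * \1_D x * density t x)%:E)%E by rewrite integral_mkcond fE.
have f0 x : (0 <= (g x * \1_D x * density t x)%:E)%E.
  by rewrite lee_fin; apply: mulr_ge0; [exact: mulr_ge0|exact: density_ge0].
have I : integrable_under t (fun x => g x * \1_D x).
  apply/integrableP; split.
    apply/measurable_EFinP; apply: measurable_funM; last exact: measurable_density.
    by apply: measurable_funM => //; exact: measurable_indic.
  by under eq_integral do rewrite gee0_abs//; rewrite -IE.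
split => //; rewrite IE /expect /Rintegral fineK//.
exact: integrable_fin_num I.
Qed.

End RestrictedExpectation.

Lemma near_scaled_lt (R : realType) (I : nat -> \bar R) (eta : R) : 0 < eta ->
  (forall n, (0 <= I n)%E) ->
  (fun n : nat => n%:R%:E * I n)%E @ \oo --> 0%E ->
  \forall n \near \oo, (I n < +oo)%E /\ (n%:R%:E * I n < eta%:E)%E.
Proof.
move=> eta0 I0 Icvg; near=> n.
(* At n = 0 the product with an infinite integral would be 0, so finiteness can be read off only for
   positive n. *)
have n0 : (0 < n)%N by near: n; exact: nbhs_infty_gt.
have nI : (n%:R%:E * I n < eta%:E)%E.
  near: n; have := Icvg [set y | (y < eta%:E)%E].
  by apply; exact: (@nbhs_open_ereal_lt R 0 (fun=> eta)).
split => //; rewrite ltNge leye_eq; apply/negP => /eqP E.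
by move: nI; rewrite E gt0_muley ?lte_fin ?ltr0n.
Unshelve. all: by end_near. Qed.

Lemma scaled_bias_le (R : realType) (p : nat)
    (M : nat -> exp_family R p) (Theta : set 'rV[R]_p)
    (Theta_open : open Theta)
    (Theta_nat : forall n, Theta `<=` natural_space (M n))
    (h : nat -> 'rV[R]_p -> R)
    (h_prop : forall n, exists2 c : R, 0 < c &
       forall theta, Theta theta -> h n theta = c * \det (fisher_info (M n) theta))
    (mml : forall n, ef_space (M n) -> 'rV[R]_p)
    (mmlP : forall n, is_MML Theta (h n) (mml n))
    (theta : 'rV[R]_p) (Theta_theta : Theta theta)
    (reg : regular_likelihood M theta)
    (mml_exists : exists_whp Theta theta (fun n => @mml_objective R p (M n) (h n)))
    (mml_tails : negligible_tails theta mml) (eta : R) : 0 < eta ->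
  \forall n \near \oo, forall i : 'I_p,
    integrable_under theta (fun x => mml n x ord0 i) /\
    n%:R * `|bias theta (mml n) ord0 i| <= eta.
Proof.
move=> eta0.
have [[c c0 coer] [r [C1 [r0 cumul]]]] := reg.
have [G [mG Gmax Gcvg]] := mml_exists.
have /nbhs_ballP[r2 /= r20 ballT] := Theta_open _ Theta_theta.
(* The sign of [C1] is not given. *)
pose C := `|C1|; have C0 : 0 <= C by exact: normr_ge0.
pose a : R := p%:R ^+ 3 * C; have a0 : 0 <= a by rewrite /a; nonneg.
(* The bounds serve, in order, |delta| <= 1, the cumulant estimates, membership in [Theta] and
   [rho_small]. *)
pose rho := Num.min 1 (Num.min r (Num.min r2 (c / 2 / (a + 1)))).
have rho0 : 0 < rho.
  by rewrite !lt_min ltr01 r0 r20 !divr_gt0// ltr_wpDl.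
have rho1 : rho <= 1 by rewrite ge_min lexx.
have rho_r : rho <= r by rewrite !ge_min lexx orbT.
have rho_r2 : rho <= r2 by rewrite !ge_min lexx !orbT.
have rho_small : p%:R ^+ 3 * C * rho <= c / 2.
  apply: le_trans (_ : (a + 1) * (c / 2 / (a + 1)) <= _).
    apply: ler_pM => //; [exact: ltW|by rewrite lerDl|by rewrite !ge_min lexx !orbT].
  by rewrite mulrC divfK// gt_eqF// ltr_wpDl.
have in_ball (s : R) t : rho <= s -> `|t - theta| < rho -> ball theta s t.
  by move=> rs tr; rewrite mx_norm_ball /ball_ /= distrC (lt_le_trans tr).
pose E := expansion_const p c C; have E0 : 0 <= E by exact: expansion_const_ge0.
have [B B0 BP] := good_event_bound E0.
pose B' := B + 3 * (1 + E); have B'0 : 0 <= B' by rewrite /B'; nonneg.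
pose k0 := 1 + (p%:R / c) ^+ 4 * 4 ^+ 4 * (2 * p%:R * expR (p%:R ^+ 2 * C)).
have k00 : 0 <= k0.
  by rewrite /k0; have := expR_ge0 (p%:R ^+ 2 * C); move=> ?; nonneg.
(* The bounds serve, in order, e < rho, the absorption condition E e <= 1/2, and a main term of at
   most eta / 4. *)
pose e := Num.min (rho / 2) (Num.min (2^-1 / (E + 1)) (eta / 4 / (B' * k0 + 1))).
have Bk : 0 <= B' * k0 by exact: mulr_ge0.
have e0 : 0 < e by rewrite !lt_min !divr_gt0// ltr_wpDl.
have e1 : e < rho.
  by apply: le_lt_trans (_ : rho / 2 < _); rewrite ?ge_min ?lexx// ltr_pdivrMr// ltr_pMr// ltr1n.
have Ee : E * e <= 2^-1.
  apply: le_trans (_ : (E + 1) * (2^-1 / (E + 1)) <= _).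
    apply: ler_pM => //; [exact: ltW|by rewrite lerDl|by rewrite !ge_min lexx !orbT].
  by rewrite mulrC divfK// gt_eqF// ltr_wpDl.
have eB : B' * (e * k0) <= eta / 4.
  rewrite mulrCA mulrC; apply: le_trans (_ : (B' * k0 + 1) * (eta / 4 / (B' * k0 + 1)) <= _).
    apply: ler_pM => //; [exact: ltW|by rewrite lerDl|by rewrite !ge_min lexx !orbT].
  by rewrite mulrC divfK// gt_eqF// ltr_wpDl.
pose kap := 1 + 3 * (1 + E) / e ^+ 2.
have kap0 : 0 < kap by rewrite /kap ltr_wpDr// divr_ge0// ?exprn_ge0 ?(ltW e0)//; nonneg.
(* The two rare events together then contribute at most eta / 2. *)
pose eta' := eta / 4 / kap.
have eta'0 : 0 < eta' by rewrite !divr_gt0.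
pose far n : set (ef_space (M n)) := [set x | e < `|mml n x - theta|].
pose IG n := (\int[ef_base (M n)]_(x in ~` G n) (density theta x)%:E)%E.
pose IF n := (\int[ef_base (M n)]_(x in far n) (`|mml n x - theta| * density theta x)%:E)%E.
have IG0 n : (0 <= IG n)%E by apply: integral_ge0 => x _; rewrite lee_fin density_ge0.
have IF0 n : (0 <= IF n)%E.
  by apply: integral_ge0 => x _; rewrite lee_fin mulr_ge0// density_ge0.
have smallG := near_scaled_lt eta'0 IG0 Gcvg.
have smallF := near_scaled_lt eta'0 IF0 (mml_tails _ e0).
near=> n.
have N1 : 1 <= n%:R :> R by near: n; exact: nbhs_infty_ger.
(* This makes N^(-1/2) < rho; the next condition bounds B' / (e N) by eta / 4. *)
have Nrho0 : (rho ^+ 2)^-1 + 1 <= n%:R by near: n; exact: nbhs_infty_ger.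
have NB0 : B' / (e * (eta / 4)) <= n%:R by near: n; exact: nbhs_infty_ger.
have coer0 : forall v : 'rV[R]_p, c * n%:R * dotr v v <=
    (v *m fisher_info (M n) theta *m v^T) ord0 ord0 by near: n; exact: coer.
have cumul0 : forall (s : seq 'I_p) (t : 'rV[R]_p), (2 <= size s <= 4)%N -> ball theta r t ->
    `|partials s (@log_partition R p (M n)) t| <= C1 * n%:R by near: n; exact: cumul.
have [IGoo nG] : (IG n < +oo)%E /\ (n%:R%:E * IG n < eta'%:E)%E by near: n; exact: smallG.
have [IFoo nF] : (IF n < +oo)%E /\ (n%:R%:E * IF n < eta'%:E)%E by near: n; exact: smallF.
move=> i.
set N : R := n%:R in N1 Nrho0 NB0 coer0 cumul0 nG nF *.
have N0 : 0 < N by exact: lt_le_trans N1.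
have Nrho : (Num.sqrt N)^-1 < rho.
  have rN : rho^-1 < Num.sqrt N.
    have ri : 0 <= rho^-1 by rewrite invr_ge0 ltW.
    rewrite -[rho^-1]ger0_norm// -sqrtr_sqr ltr_sqrt// exprVn.
    by apply: lt_le_trans Nrho0; rewrite ltrDl.
  by rewrite -[ltRHS]invrK ltf_pV2// posrE ?invr_gt0// sqrtr_gt0.
have NB : B' * (e * N)^-1 <= eta / 4.
  have ee : 0 < e * (eta / 4) by rewrite mulr_gt0// divr_gt0.
  rewrite ler_pdivrMr ?mulr_gt0//.
  have -> : eta / 4 * (e * N) = N * (e * (eta / 4)) by ring.
  by move: NB0; rewrite ler_pdivrMr.
have coerN : coercive (c * N) (fisher_info (M n) theta).
  move=> v; apply: le_trans (coer0 v); apply: ler_wpM2l; last exact: sqr_norm_le_dotr.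
  by rewrite mulr_ge0 ?(ltW c0) ?(ltW N0).
have cumN s t : (2 <= size s <= 4)%N -> `|t - theta| < rho ->
    `|partials s (@log_partition R p (M n)) t| <= C * N.
  move=> s24 tr; apply: le_trans (_ : C1 * N <= _); last first.
    by rewrite ler_wpM2r ?(ltW N0)// ler_norm.
  exact: cumul0 s24 (in_ball _ _ rho_r tr).
have mest := (mmlP n).1.
have mnorm : measurable_fun setT (fun x => `|mml n x - theta|).
  apply: measurable_norm_rV => j.
  rewrite (_ : (fun x => _) = (fun x => mml n x ord0 j - theta ord0 j)).
    by apply: measurable_funB => //; exact: mest.
  by apply/funext => x; rewrite !mxE.
have mfar : measurable (far n).
  have := measurable_fun_ltr (measurable_cst e) mnorm.
  by move=> /(_ measurableT [set true] _); rewrite setTI; apply.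
have mGc : measurable (~` G n) by apply: measurableC; exact: mG.
have EF := @expect_restrict _ _ _ theta (far n) _ mfar mnorm (fun x => normr_ge0 _) IFoo.
have [Ifar Efar] := EF.
have [IGc EGc] : integrable_under theta (\1_(~` G n) : ef_space (M n) -> R) /\
    (expect theta (\1_(~` G n) : ef_space (M n) -> R))%:E = IG n.
  have one : (fun x => (1 * density theta x)%:E) = (fun x : ef_space (M n) => (density theta x)%:E).
    by apply/funext => x; rewrite mul1r.
  have oneI : (fun x => 1 * \1_(~` G n) x) = (\1_(~` G n) : ef_space (M n) -> R).
    by apply/funext => x; rewrite mul1r.
  have := @expect_restrict _ _ _ theta (~` G n) (fun=> 1) mGc (measurable_cst _) (fun=> ler01).
  by rewrite one oneI; apply.
have [kn kn0 hE] := h_prop n.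
have argmaxG x : G n x -> is_argmax Theta (mml_objective (h n) x) (mml n x).
  by move=> /Gmax; exact: (mmlP n).2.
have ballT' t : `|t - theta| < rho -> Theta t by move=> /(in_ball _ _ rho_r2); exact: ballT.
have [Iest bound] := model_bias_le Theta_open (Theta_nat n) rho0 rho1 c0 C0 N1 rho_small ballT'
  coerN cumN Nrho e0 e1 E0 Ee B0 BP kn0 hE mest (mG n) argmaxG Ifar i.
split => //; apply: le_trans bound _.
have nG' : N * expect theta (\1_(~` G n) : ef_space (M n) -> R) <= eta'.
  by move: nG; rewrite -EGc -EFinM lte_fin => /ltW.
have nF' : N * expect theta (fun x => `|mml n x - theta| * \1_(far n) x) <= eta'.
  by move: nF; rewrite /IF -Efar -EFinM lte_fin => /ltW.
have tail : kap * (N * expect theta (\1_(~` G n) : ef_space (M n) -> R) +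
    N * expect theta (fun x => `|mml n x - theta| * \1_(far n) x)) <= eta / 2.
  apply: le_trans (ler_wpM2l (ltW kap0) (lerD nG' nF')) _.
  by rewrite le_eqVlt; apply/orP; left; apply/eqP; rewrite /eta'; field; rewrite gt_eqF.
rewrite -/B' -/k0 -/kap [B' * _]mulrDr.
apply: le_trans (lerD (lerD eB NB) tail) _.
by rewrite le_eqVlt; apply/orP; left; apply/eqP; field.
Unshelve. all: by end_near. Qed.

Theorem proposition3p1 (R : realType) (p : nat) (hp : (1 <= p)%N)
    (M : nat -> exp_family R p)
    (Theta : set 'rV[R]_p)
    (Theta_open : open Theta)
    (Theta_nat : forall n, Theta `<=` natural_space (M n))
    (h : nat -> 'rV[R]_p -> R)
    (h_prop : forall n, exists2 c : R, 0 < c &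
       forall theta, Theta theta -> h n theta = c * \det (fisher_info (M n) theta))
    (mle mml : forall n, ef_space (M n) -> 'rV[R]_p)
    (mleP : forall n, is_MLE Theta (mle n))
    (mmlP : forall n, is_MML Theta (h n) (mml n))
    (theta : 'rV[R]_p) (Theta_theta : Theta theta)
    (reg : regular_likelihood M theta)
    (mml_exists : exists_whp Theta theta (fun n => @mml_objective R p (M n) (h n)))
    (mml_tails : negligible_tails theta mml)
    (m : nat) (hm : (1 <= m)%N) (b : nat -> 'rV[R]_p)
    (mle_bias : bias_expansion m theta mle b) :
  bias_expansion 1 theta mml (fun _ => 0) /\
  (forall (k : nat) (c : nat -> 'rV[R]_p), (1 <= k)%N ->
     bias_expansion k theta mml c -> c 1%N = 0).
Proof.
have small := @scaled_bias_le R p M Theta Theta_open Theta_nat h h_prop mml mmlP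
  theta Theta_theta reg mml_exists mml_tails.
have small_norm (eta : R) : 0 < eta ->
    \forall n \near \oo, `|n%:R *: bias theta (mml n)| <= eta.
  move=> eta0; have := small _ eta0; apply: filterS => n H.
  apply: mx_norm_le => [|i j]; first exact: ltW.
  by rewrite mxE normrM (ord1 i) normr_nat; case: (H j).
split.
  split; first by have := small 1 ltr01; apply: filterS => n H i; case: (H i).
  apply/cvgr0Pnorm_le => eta eta0; have := small_norm _ eta0; apply: filterS => n.
  by rewrite expr1 big1 ?subr0// => j _; rewrite scaler0.
(* The vector [c 1] does not depend on n, so it suffices to bound its norm by every positive eta, at
   a single large n. *)
move=> k c k1 [_ expansion]; apply/eqP; rewrite -normr_le0.
apply/ler_addgt0Pr => eta eta0; rewrite add0r.
have eta3 : 0 < eta / 3 by rewrite divr_gt0.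
pose Sc := \sum_(2 <= j < k.+1) `|c j|.
near \oo => n.
have n1 : 1 <= n%:R :> R by near: n; exact: nbhs_infty_ger.
have n0 : 0 < n%:R :> R by exact: lt_le_trans n1.
have H1 : `|n%:R *: bias theta (mml n)| <= eta / 3 by near: n; exact: small_norm.
have H2 : `|n%:R ^+ k *: (bias theta (mml n) - \sum_(1 <= j < k.+1) n%:R ^- j *: c j)| <= eta / 3.
  by near: n; have /cvgr0Pnorm_le := expansion; apply.
(* After multiplication by n every term of index at least 2 is still of order 1/n. *)
have H3 : `|\sum_(2 <= j < k.+1) n%:R *: (n%:R ^- j *: c j)| <= eta / 3.
  have nS : Sc / (eta / 3) <= n%:R by near: n; exact: nbhs_infty_ger.
  apply: le_trans (_ : n%:R^-1 * Sc <= _); last first.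
    by rewrite mulrC ler_pdivrMr// mulrC -ler_pdivrMr.
  apply: le_trans (ler_norm_sum _ _ _) _; rewrite mulr_sumr.
  rewrite big_nat_cond [leRHS]big_nat_cond; apply: ler_sum => j /andP[/andP[j2 _] _].
  rewrite !normrZ mulrA ler_wpM2r// normrV ?unitfE ?expf_neq0 ?gt_eqF//.
  rewrite normrX normr_nat ler_pdivrMr ?exprn_gt0// -ler_pdivrMl ?invr_gt0// invrK -expr2.
  exact: ler_weXn2l.
(* The expansion controls n^k times the remainder, hence also n times it, as 1 <= k and 1 <= n. *)
have H2' : `|n%:R *: (bias theta (mml n) - \sum_(1 <= j < k.+1) n%:R ^- j *: c j)| <= eta / 3.
  apply: le_trans H2; rewrite !normrZ ler_wpM2r// normrX normr_nat.
  by rewrite -[leLHS]expr1 ler_weXn2l.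
have -> : c 1%N = n%:R *: bias theta (mml n) -
   n%:R *: (bias theta (mml n) - \sum_(1 <= j < k.+1) n%:R ^- j *: c j) -
   \sum_(2 <= j < k.+1) n%:R *: (n%:R ^- j *: c j).
  have cancel (x a y : 'rV[R]_p) : x - (x - (a + y)) - y = a.
    by apply/rowP => i; rewrite !mxE; ring.
  rewrite -scaler_sumr big_ltn// -!scalerBr cancel expr1 scalerA divff ?scale1r//.
  by rewrite gt_eqF.
apply: le_trans (ler_normB _ _) _; apply: le_trans (lerD (ler_normB _ _) (lexx _)) _.
apply: le_trans (lerD (lerD H1 H2') H3) _.
by rewrite le_eqVlt; apply/orP; left; apply/eqP; field.
Unshelve. all: by end_near. Qed.
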